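(* Let $\mathcal{S}$ be a reduced linear subspace of $\mathrm{Mat}_{m,n}(\mathbb{K})$. Set $r:=\mathrm{urk}(\mathcal{S})$ and assume $\#\mathbb{K}>r\geq 2$. (a) If $\mathcal{S}$ has the column property and $r\geq 4$, then $\mathrm{trk}(\mathcal{S})\leq\binom{r}{2}$. (b) If $\mathcal{S}$ is semi-primitive, then $\mathrm{trk}(\mathcal{S})\leq 3+\binom{r-1}{2}$.
   Context: $\mathrm{urk}$ is the maximal rank in a space; $\mathrm{trk}(\mathcal{S}):=\max_{x\in\mathbb{K}^n}\dim\{Mx\mid M\in\mathcal{S}\}$. Matrix spaces are equivalent ($\sim$) if $\mathcal{M}=P\mathcal{M}'Q$ with $P,Q$ invertible. $\mathcal{S}$ is reduced if no nonzero vector is annihilated by all its matrices and the sum of column spaces of its matrices is $\mathbb{K}^m$. A subspace is defective if none of its matrices has rank equal to its number of columns. $\mathcal{S}$ is $(r,s)$-decomposed ($0\le r\le m$, $1\le s\le n$) if every $M\in\mathcal{S}$ is of the form $\begin{bmatrix} ?_{r\times s}& C(M)\\ B(M)&0_{(m-r)\times(n-s)}\end{bmatrix}$, with lower space $B(\mathcal{S})$; $\mathcal{S}$ has the column property if for every such $(r,s)$ and every $(r,s)$-decomposed $\mathcal{S}'\sim\mathcal{S}$, the lower space of $\mathcal{S}'$ is defective. For an operator space $\mathcal{T}\subseteq\mathcal{L}(U,V)$: $\mathcal{T}$ is $c$-defective if $\dim\ker f\geq c$ for all $f\in\mathcal{T}$; its defectiveness index is the greatest such $c$; $\mathcal{T}$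 is semi-primitive if it is reduced and there is no linear hyperplane $U'$ of $U$ such that $\{f_{|U'}\mid f\in\mathcal{T}\}$ is $c$-defective, $c$ being the defectiveness index of $\mathcal{T}$. A matrix space in $\mathrm{Mat}_{m,n}(\mathbb{K})$ is semi-primitive if the corresponding subspace of $\mathcal{L}(\mathbb{K}^n,\mathbb{K}^m)$ is. *)

(* Defs.v *)
From HB Require Import structures.
From mathcomp Require Import all_boot all_order all_algebra.
Set Implicit Arguments. Unset Strict Implicit. Unset Printing Implicit Defensive.
Import Order.TTheory GRing.Theory Num.Theory.
Local Open Scope ring_scope.

Section MatrixSpaces.
Variables (K : fieldType) (m n : nat).
Implicit Types (S : {vspace 'M[K]_(m, n)}).

Definition card_gt (k : nat) : Prop :=
  exists s : seq K, uniq s /\ (k < size s)%N.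

Definition is_urk S (k : nat) : Prop :=
  (exists2 M, M \in S & \rank M = k) /\ (forall M, M \in S -> (\rank M <= k)%N).

Definition img_at S (x : 'cV[K]_n) : {vspace 'cV[K]_m} :=
  (linfun (fun M : 'M[K]_(m, n) => M *m x) @: S)%VS.

Definition is_trk S (t : nat) : Prop :=
  (exists x, \dim (img_at S x) = t) /\ (forall x, (\dim (img_at S x) <= t)%N).

Definition reduced S : Prop :=
  (forall x : 'cV[K]_n, (forall M, M \in S -> M *m x = 0) -> x = 0) /\
  (forall y : 'cV[K]_m, exists (k : nat) (Ms : 'I_k -> 'M[K]_(m, n)) (xs : 'I_k -> 'cV[K]_n),
      (forall i, Ms i \in S) /\ y = \sum_(i < k) Ms i *m xs i).

Definition mxspace_equiv S S' : Prop :=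
  exists (P : 'M[K]_m) (Q : 'M[K]_n), P \in unitmx /\ Q \in unitmx /\
    forall M, M \in S <-> exists2 M', M' \in S' & M = P *m M' *m Q.

Definition decomposed (r s : nat) S : Prop :=
  forall M, M \in S -> forall (i : 'I_m) (j : 'I_n), (r <= i)%N -> (s <= j)%N -> M i j = 0.

Lemma low_row_proof (r : nat) (i : 'I_(m - r)) : (r + i < m)%N.
Proof. by rewrite -ltn_subRL. Qed.

Definition lower_block (r s : nat) (hs : (s <= n)%N) (M : 'M[K]_(m, n)) : 'M[K]_(m - r, s) :=
  \matrix_(i < m - r, j < s) M (Ordinal (low_row_proof i)) (widen_ord hs j).

Definition lower_defective (r s : nat) (hs : (s <= n)%N) S : Prop :=
  forall M, M \in S -> \rank (lower_block r hs M) != s.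

Definition column_property S : Prop :=
  forall (r s : nat) (hr : (r <= m)%N) (hs1 : (1 <= s)%N) (hs : (s <= n)%N)
         (S' : {vspace 'M[K]_(m, n)}),
    decomposed r s S' -> mxspace_equiv S S' -> lower_defective r hs S'.

Definition kerM (M : 'M[K]_(m, n)) : {vspace 'cV[K]_n} :=
  lker (linfun (fun x : 'cV[K]_n => M *m x)).

Definition c_defective S (c : nat) : Prop :=
  forall M, M \in S -> (c <= \dim (kerM M))%N.

Definition is_defect_index S (c : nat) : Prop :=
  c_defective S c /\ forall c', c_defective S c' -> (c' <= c)%N.

Definition restr_c_defective S (U' : {vspace 'cV[K]_n}) (c : nat) : Prop :=
  forall M, M \in S -> (c <= \dim (kerM M :&: U'))%N.

Definition semi_primitive S : Prop :=
  reduced S /\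
  forall c, is_defect_index S c ->
    ~ exists U' : {vspace 'cV[K]_n}, (\dim U').+1 = n /\ restr_c_defective S U' c.

End MatrixSpaces.

(* Main.v *)
Require Import Defs.
From HB Require Import structures.
From mathcomp Require Import all_boot all_order all_algebra.
From mathcomp Require Import perm zify.
From Stdlib Require Import Classical.
Import Order.TTheory GRing.Theory Num.Theory.
Set Implicit Arguments. Unset Strict Implicit. Unset Printing Implicit Defensive.
Local Open Scope ring_scope.

(** Matrices act on row vectors.  If [A] has maximal rank [r], the Flanders-Atkinson argument
on the pencils [l A + M] shows that all [M] send [Ker A] into [Im A], and more precisely
that, in coordinates where [A] is the identity of [K^r] bordered by zeros,
[M = [a, b; c, 0]] with [c a^j b = 0] for all [j].  Reducing modulo [Im A] lowers the rank, so
the images of a space with the column property span at most [C(r+1, 2)] dimensions.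

For a semi-primitive space, the case where all [b] have rank at most [r - 2] is handled by
induction; otherwise all [c] have rank at most 1, and either they have their images in a
common line (again induction) or [Ker A] is a line.  In the latter case [b] induces an
alternating map on the span [D] of the [c], which bounds the total image unless
[dim D >= r - 1]; these two extreme cases use the identities with [j >= 1] and the fact that
the kernels of the matrices of rank [r] do not all lie in a hyperplane.

A space with the column property which is not semi-primitive has a restriction to a minimal
subspace of codimension [s >= 1] which has rank [r - s] and is semi-primitive; adding the
row bounds [C(r-s+1, 2)] and [C(s, 2)] of the two diagonal pieces gives at most [C(r, 2)]. *)

(** * Ranks and pencils *)

Section Ranks.
Variable K : fieldType.

(** Right multiplication by [cokermx V] is reduction modulo the row space of [V]; the part of [X]
    that it kills lies in [V]. *)
Lemma rank_le_mul_coker p q m (X : 'M[K]_(p, m)) (V : 'M_(q, m)) :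
  (\rank X <= \rank (X *m cokermx V) + \rank V)%N.
Proof.
rewrite -{1}(mxrank_mul_ker X (cokermx V)) leq_add2l.
apply: leq_trans (mxrankS (capmxSr _ _)) _.
rewrite mxrank_ker mxrank_coker subKn //; exact: rank_leq_col.
Qed.

Lemma rank_mul_sub p q n m (U : 'M[K]_(p, n)) (Y : 'M_(q, n)) (X : 'M_(n, m)) :
  (Y <= U)%MS -> (\rank (U *m X) + \rank Y <= \rank U + \rank (Y *m X))%N.
Proof.
move=> sYU; rewrite -(mxrank_mul_ker U X) -(mxrank_mul_ker Y X).
have : (\rank (Y :&: kermx X) <= \rank (U :&: kermx X))%N.
  by apply: mxrankS; apply: capmxS.
lia.
Qed.

Lemma row_free_right_inv p m (Y : 'M[K]_(p, m)) :
  row_free Y -> exists Q, Y *m Q = 1%:M.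
Proof. by case/row_freeP=> Q; exists Q. Qed.

(** Fixed [P] and [Q] turn a lower bound on a rank into the invertibility of an [a] by [a] matrix,
    which can then be followed along a pencil by a characteristic polynomial. *)
Lemma rank_ge_section a p q (X : 'M[K]_(p, q)) : (a <= \rank X)%N ->
  exists P Q, P *m X *m Q = 1%:M :> 'M_a.
Proof.
move=> leaX.
have leap : (a <= p)%N := leq_trans leaX (rank_leq_row X).
exists (pid_mx a *m invmx (col_ebase X)), (invmx (row_ebase X) *m pid_mx a).
rewrite -{2}(mulmx_ebase X) !mulmxA mulmxKV ?col_ebase_unit //.
rewrite mulmxK ?row_ebase_unit // !mul_pid_mx.
have -> : minn q (minn (minn p (minn a (\rank X))) a) = a.
  by have := rank_leq_col X; lia.
exact: pid_mx_1.
Qed.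

Lemma rank_section_le a p q (P : 'M[K]_(a, p)) (X : 'M_(p, q)) (Q : 'M_(q, a)) :
  P *m X *m Q \in unitmx -> (a <= \rank X)%N.
Proof.
move=> /mxrank_unit <-; apply: leq_trans (mxrankM_maxl _ _) _; exact: mxrankM_maxr.
Qed.

Lemma root_char_poly_unit r (X : 'M[K]_r) (l : K) :
  root (char_poly X) l = (l%:M - X \notin unitmx).
Proof.
rewrite -eigenvalue_root_char /eigenvalue /eigenspace kermx_eq0 row_free_unit.
by rewrite -opprB -scaleN1r unitmxZ // unitrN unitr1.
Qed.

(** A characteristic polynomial of degree [r] cannot vanish at more than [r] scalars. *)
Lemma exists_noneigenvalue r (X : 'M[K]_r) : card_gt K r ->
  exists l, l%:M + X \in unitmx.
Proof.
move=> [s [us ls]].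
have [/allP h|] := boolP (all (root (char_poly (- X))) s).
  have := max_poly_roots (monic_neq0 (char_poly_monic (- X))) (introT allP h) us.
  by rewrite size_char_poly ltnNge ls.
case/allPn=> l _; rewrite root_char_poly_unit negbK opprK => h.
by exists l.
Qed.

(** If [y] were outside [A], a basis of [A] together with [y] would have a right inverse [Q]. After
    multiplication by [Q], suitable rows of [l A + M] together with [y] become block triangular with
    diagonal blocks [l + X] and 1, so some [l] gives rank [r + 1]. *)
Lemma pencil_sub_image r n m (A M : 'M[K]_(n, m)) (y : 'rV_m) :
  card_gt K r -> \rank A = r -> (forall l, (\rank (l *: A + M)%R <= r)%N) ->
  (forall l, (y <= (l *: A + M)%R)%MS) -> (y <= A)%MS.
Proof.
move=> cK rA rM yM; apply/negPn/negP=> yA.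
move: rM yM yA; rewrite -rA in cK *; move=> rM yM yA.
have [E defE] : exists E, row_base A = E *m A by apply/submxP; rewrite eq_row_base.
have fY : row_free (col_mx (row_base A) y).
  rewrite -row_leq_rank -addsmxE.
  have -> : \rank (row_base A + y)%MS = \rank (A + y)%MS.
    by apply/eqmx_rank/eqmxP/adds_eqmx => //; exact: eq_row_base.
  have lt : (A < A + y)%MS by rewrite /ltmx addsmxSl addsmx_sub submx_refl.
  by rewrite addn1; apply: rank_ltmx.

have [Q YQ] := row_free_right_inv fY.
have [l hl] := exists_noneigenvalue (E *m M *m lsubmx Q) cK.
have : (\rank (col_mx (E *m (l *: A + M)) y) <= \rank A)%N.
  apply: leq_trans (rM l); apply: mxrankS.
  by rewrite -addsmxE addsmx_sub submxMl yM.
apply/negP; rewrite -ltnNge.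
have {YQ} : col_mx (row_base A) y *m Q = block_mx 1%:M 0 0 1%:M.
  by rewrite YQ -scalar_mx_block.
rewrite -{1}(hsubmxK Q) mul_col_row => /eq_block_mx [h1 h2 h3 h4].
have : col_mx (E *m (l *: A + M)) y *m Q \in unitmx.
  rewrite -{1}(hsubmxK Q) mul_col_row h3 h4 unitmxE det_ublock det1 mulr1 -unitmxE.
  by rewrite mulmxDr mulmxDl -scalemxAr -defE -scalemxAl h1 scalemx1.
move/mxrank_unit=> h; rewrite -[X in (X <= _)%N]addn1 -[X in (X <= _)%N]h; exact: mxrankM_maxl.
Qed.

(* [z - zMA'/l + zMA'MA'/l^2 - ...] is a formal kernel vector of [l A + M], [A'] being a pseudo-inverse of [A]. *)
Lemma iterated_image_sub r n m (A M : 'M[K]_(n, m)) (A' : 'M_(m, n)) (z : 'rV_n) :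
  card_gt K r -> \rank A = r -> (forall l, (\rank (l *: A + M)%R <= r)%N) ->
  A *m A' *m A = A -> z *m A = 0 ->
  forall j, (iter j (fun w => w *m M *m A') z *m M <= A)%MS.
Proof.
move=> cK rA rM AA zA j.
set w := fun j => iter j (fun w => w *m M *m A') z.
have wS i : (w i *m M <= A)%MS -> w i.+1 *m A = w i *m M.
  by case/submxP=> u e; rewrite /w /= -/(w i) e -!mulmxA (mulmxA A) AA.
suff: forall i, (i <= j)%N -> (w i *m M <= A)%MS by move/(_ j (leqnn j)).
elim/ltn_ind=> i IH lei.
apply: (pencil_sub_image cK rA rM) => l.
(* For fixed [l], the terms are placed in the row space of [l A + M] one after the other: the
   relation [w h.+1 *m A = w h *m M] makes the series telescope. *)
have: forall h, (h <= i)%N -> (w h *m M <= (l *: A + M)%R)%MS; last by apply.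
elim=> [|h IHh] leh.
  have -> : w 0 *m M = w 0 *m (l *: A + M) by rewrite mulmxDr -scalemxAr zA scaler0 add0r.
  exact: submxMl.
have e : w h.+1 *m A = w h *m M by apply/wS/IH => //; lia.
have -> : w h.+1 *m M = w h.+1 *m (l *: A + M) - l *: (w h *m M).
  by rewrite mulmxDr -scalemxAr e [RHS]addrC addKr.
apply: addmx_sub; first exact: submxMl.
rewrite eqmx_opp; apply: scalemx_sub; apply: IHh; exact: ltnW.
Qed.

End Ranks.

(** * Linear families of matrices *)

Section Families.
Variables (K : fieldType) (k : nat).

(* A matrix space is handled through a linear parametrisation by ['rV_k]; its
   members act on row vectors, so they are the transposes of those of the paper. *)
Notation family n m := ('rV[K]_k -> 'M[K]_(n, m)).

(** This is the matrix of the linear map sending [t] to [x *m M t], so its rank is the dimension of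
    the image at [x], whose maximum over [x] is trk. *)
Definition ev n m (M : family n m) (x : 'rV_n) : 'M_(k, m) :=
  \matrix_i (x *m M (delta_mx 0 i)).

Definition total_image n m (M : family n m) : 'M_m :=
  (\sum_(i < k) <<M (delta_mx 0 i)>>)%MS.

Definition rank_bounded r n m (M : family n m) := forall t, (\rank (M t) <= r)%N.

(** A coordinate-free column property: [M t *m Q] kills [W], hence factors through a quotient of
    dimension [n - \rank W >= 1], the number of columns of the lower block, and defectiveness says
    that this rank is not reached. *)
Definition column_prop n m (M : family n m) :=
  forall p w (Q : 'M_(m, p)) (W : 'M_(w, n)),
  (\rank W < n)%N -> (forall t, W *m M t *m Q = 0) ->
  forall t, (\rank (M t *m Q) + \rank W < n)%N.

(** When [r] is the upper rank, the defectiveness index is [n - r], and restricting to a hyperplane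
    keeps this index exactly when the rank drops below [r] there. *)
Definition semi_prim r n m (M : family n m) :=
  forall H : 'M_n, (\rank H).+1 = n -> exists t, (r <= \rank (H *m M t))%N.

Lemma linear_add n m (M : family n m) : linear M -> {morph M : u v / u + v}.
Proof. by move=> lM u v; rewrite -[u]scale1r lM !scale1r. Qed.

Lemma linear_zero n m (M : family n m) : linear M -> M 0 = 0.
Proof. by move=> lM; apply: (addrI (M 0)); rewrite -linear_add // !addr0. Qed.

Lemma linear_scale n m (M : family n m) : linear M -> forall a u, M (a *: u) = a *: M u.
Proof. by move=> lM a u; rewrite -[a *: u]addr0 lM linear_zero // addr0. Qed.

Lemma linear_opp n m (M : family n m) : linear M -> {morph M : u / - u}.
Proof. by move=> lM u; rewrite -scaleN1r linear_scale // scaleN1r. Qed.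

Lemma linear_mulr n m p (M : family n m) (Q : 'M_(m, p)) :
  linear M -> linear (fun t => M t *m Q).
Proof. by move=> lM a u v; rewrite lM mulmxDl scalemxAl. Qed.

Lemma linear_mull n m p (P : 'M_(p, n)) (M : family n m) :
  linear M -> linear (fun t => P *m M t).
Proof. by move=> lM a u v; rewrite lM mulmxDr scalemxAr. Qed.

Lemma row_sum_ev n m (M : family n m) : linear M ->
  forall t, M t = \sum_i t 0 i *: M (delta_mx 0 i).
Proof.
move=> lM t; rewrite {1}(row_sum_delta t).
rewrite (big_morph M (linear_add lM) (linear_zero lM)).
by apply: eq_bigr => i _; rewrite linear_scale.
Qed.

Lemma mul_ev n m (M : family n m) : linear M -> forall x t, t *m ev M x = x *m M t.
Proof.
move=> lM x t; rewrite mulmx_sum_row (row_sum_ev lM) mulmx_sumr.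
by apply: eq_bigr => i _; rewrite rowK scalemxAr.
Qed.

Lemma ev_sub n m (M : family n m) x p (V : 'M_(p, m)) :
  (forall t, (x *m M t <= V)%MS) -> (ev M x <= V)%MS.
Proof. by move=> h; apply/row_subP=> i; rewrite rowK. Qed.

Lemma sub_ev n m (M : family n m) : linear M -> forall x t, (x *m M t <= ev M x)%MS.
Proof. by move=> lM x t; rewrite -(mul_ev lM) submxMl. Qed.

Lemma ev_mulr n m p (M : family n m) x (Q : 'M_(m, p)) :
  ev (fun t => M t *m Q) x = ev M x *m Q.
Proof. by apply/row_matrixP=> i; rewrite row_mul !rowK mulmxA. Qed.

Lemma total_image_sub n m (M : family n m) p (V : 'M_(p, m)) :
  (forall t, (M t <= V)%MS) -> (total_image M <= V)%MS.
Proof. by move=> h; apply/sumsmx_subP=> i _; rewrite genmxE. Qed.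

Lemma sub_total_image n m (M : family n m) : linear M -> forall t, (M t <= total_image M)%MS.
Proof.
move=> lM t; rewrite (row_sum_ev lM); apply: summx_sub => i _; apply: scalemx_sub.
by apply: (submx_trans _ (sumsmx_sup i _ (submx_refl _))); rewrite ?genmxE.
Qed.

Lemma rank_ev_total_image n m (M : family n m) x : linear M ->
  (\rank (ev M x) <= \rank (total_image M))%N.
Proof.
move=> lM; apply/mxrankS/ev_sub => t.
exact: submx_trans (submxMl _ _) (sub_total_image lM _).
Qed.

Lemma column_prop_mulr n m p (M : family n m) (Q : 'M_(m, p)) :
  column_prop M -> column_prop (fun t => M t *m Q).
Proof.
move=> cM q w Q' W rW WMQ t /=; rewrite -mulmxA; apply: cM => // u.
by have := WMQ u; rewrite /= !mulmxA.
Qed.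

Lemma pencil_rank r n m t0 (M : family n m) : linear M ->
  rank_bounded r M -> forall t l, (\rank (l *: M t0 + M t)%R <= r)%N.
Proof. by move=> lM rM t l; rewrite -lM. Qed.

(** Every member maps [Ker A] into [Im A], where [A = M t0]; so [W = kermx A] and [Q = cokermx A]
    are admissible in the column property, whose bound is [n - (n - r.+1)], not reached. *)
Lemma rank_bounded_coker r n m (M : family n m) t0 : card_gt K r.+1 ->
  linear M -> rank_bounded r.+1 M -> column_prop M -> \rank (M t0) = r.+1 ->
  rank_bounded r (fun t => M t *m cokermx (M t0)).
Proof.
move=> cK lM rM cM r0 t.
have len : (r.+1 <= n)%N by rewrite -r0 rank_leq_row.
have rker : \rank (kermx (M t0)) = (n - r.+1)%N by rewrite mxrank_ker r0.
suff kerM u : kermx (M t0) *m M u *m cokermx (M t0) = 0.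
  have lt : (\rank (kermx (M t0)) < n)%N by rewrite rker; lia.
  have := cM _ _ _ _ lt kerM t; rewrite rker; lia.
apply/eqP; rewrite -submxE; apply/row_subP=> i; rewrite row_mul.
have zA : row i (kermx (M t0)) *m M t0 = 0 by rewrite -row_mul mulmx_ker row0.
have := iterated_image_sub cK r0 (pencil_rank t0 lM rM u) (mulmxKpV (submx_refl _)) zA 0.
exact.
Qed.

Lemma card_gtW r s : (s <= r)%N -> card_gt K r -> card_gt K s.
Proof. by move=> le [l [u h]]; exists l; split=> //; apply: leq_ltn_trans h. Qed.

Lemma total_image_mulr n m p (M : family n m) (Q : 'M_(m, p)) : linear M ->
  (total_image M *m Q <= total_image (fun t => M t *m Q))%MS.
Proof.
move=> lM; rewrite sumsmxMr_gen; apply/sumsmx_subP=> i _; rewrite genmxE.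
apply: submx_trans (sub_total_image (linear_mulr Q lM) (delta_mx 0 i)).
by apply: submxMr; rewrite genmxE.
Qed.

Lemma rank_total_image_mod n m q (M : family n m) (V : 'M_(q, m)) : linear M ->
  (\rank (total_image M) <= \rank (total_image (fun t => M t *m cokermx V)) + \rank V)%N.
Proof.
move=> lM; apply: leq_trans (rank_le_mul_coker _ V) _; rewrite leq_add2r.
exact/mxrankS/(total_image_mulr _ lM).
Qed.

(** Reducing modulo the image of a member of rank [r.+1] costs [r.+1] dimensions and lowers the rank
    bound by one; the costs add up to a triangular number. *)
Lemma rank_total_image r n m (M : family n m) : card_gt K r -> linear M ->
  rank_bounded r M -> column_prop M -> (\rank (total_image M) <= 'C(r.+1, 2))%N.
Proof.
elim: r n m M => [|r IH] n m M cK lM rM cM.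
  rewrite leqn0 mxrank_eq0 -submx0; apply: total_image_sub => t.
  by rewrite submx0 -mxrank_eq0 -leqn0.
have cK' : card_gt K r by apply: card_gtW cK.
have [[t0 r0]|no] := classic (exists t, \rank (M t) = r.+1).
  apply: leq_trans (rank_total_image_mod (M t0) lM) _.
  rewrite r0 binS bin1 leq_add2r; apply: IH => //; first exact: linear_mulr.
    exact: rank_bounded_coker.
  exact: column_prop_mulr.
apply: leq_trans (IH _ _ _ cK' lM _ cM) _; last by rewrite (binS r.+1) leq_addr.
move=> t; rewrite -ltnS ltn_neqAle rM andbT; apply/eqP=> e; apply: no; by exists t.
Qed.

(** On the line [t1 + l t2] the two conditions follow from the invertibility of [1 + l X'] and of
    [l + Y'], which excludes finitely many [l]. *)
Lemma pencil_good_ranks r p q p' q' (X : family p q) (Y : family p' q') a b t1 t2 :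
  card_gt K r -> linear X -> linear Y -> (a <= \rank (X t1))%N -> (b <= \rank (Y t2))%N -> (a + b <= r.+1)%N ->
  exists t, (a <= \rank (X t))%N /\ (b <= \rank (Y t))%N.
Proof.
move=> [s [us ss]] lX lY ha hb hab.
have [P1 [Q1 e1]] := rank_ge_section ha; have [P2 [Q2 e2]] := rank_ge_section hb.
set X' := P1 *m X t2 *m Q1; set Y' := P2 *m Y t1 *m Q2.
have [uX|nuX] := boolP (X' \in unitmx).
  by exists t2; split=> //; apply: rank_section_le uX.
(* A singular [X'] has the root 0, which excludes no [l]: at most [a - 1] scalars are bad for [X]
   and [b] for [Y]. Saving this one makes [a + b <= r.+1] sufficient. *)
have X0 : root (char_poly X') 0.
  by rewrite root_char_poly_unit raddf0 sub0r -scaleN1r unitmxZ ?unitrN ?unitr1.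
pose Bx := [seq l <- s | (l != 0) && root (char_poly X') (- l^-1)].
pose By := [seq l <- s | root (char_poly (- Y')) l].
have sBx : (size Bx < a)%N.
  have := @max_poly_roots _ (char_poly X') (0 :: [seq - l^-1 | l <- Bx]).
  rewrite size_char_poly /= size_map ltnS; apply; first exact: monic_neq0 (char_poly_monic _).
    rewrite X0 /=; apply/allP=> _ /mapP[l + ->]; rewrite mem_filter.
    by case/andP=> /andP[].
  rewrite map_inj_uniq ?filter_uniq // ?andbT; last by move=> u v /oppr_inj /invr_inj.
  apply/mapP=> -[l]; rewrite mem_filter => /andP[/andP[l0 _] _] /esym/eqP.
  by rewrite oppr_eq0 invr_eq0 (negPf l0).
have sBy : (size By <= b)%N.
  have := @max_poly_roots _ (char_poly (- Y')) By.
  rewrite size_char_poly ltnS; apply; first exact: monic_neq0 (char_poly_monic _).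
    by apply/allP=> l; rewrite mem_filter => /andP[].
  exact: filter_uniq.
have [sub|] := boolP (all (mem (Bx ++ By)) s).
  have := uniq_leq_size us (allP sub); rewrite size_cat; move: sBx sBy ss.
  by move: (size Bx) (size By) (size s) => i j l; lia.
case/allPn=> l ls; rewrite inE mem_cat !mem_filter ls !andbT negb_or => /andP[hx hy].
exists (t1 + l *: t2); split.
  apply: (@rank_section_le _ _ _ _ P1 _ Q1).
  rewrite linear_add // linear_scale // mulmxDr mulmxDl e1 -scalemxAr -scalemxAl -/X'.
  have [->|l0] := eqVneq l 0; first by rewrite scale0r addr0 unitmx1.
  move: hx; rewrite l0 /= root_char_poly_unit negbK => h.
  have -> : 1%:M + l *: X' = (- l) *: ((- l^-1)%:M - X').
    by rewrite scalerBr scale_scalar_mx mulrNN divff // scaleNr opprK.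
  by rewrite unitmxZ // unitfE oppr_eq0.
apply: (@rank_section_le _ _ _ _ P2 _ Q2).
rewrite linear_add // linear_scale // mulmxDr mulmxDl -scalemxAr -scalemxAl e2 -/Y' scalemx1 addrC.
by move: hy; rewrite root_char_poly_unit negbK opprK.
Qed.

Lemma exists_hyperplane_above w n (W : 'M[K]_(w, n)) : (\rank W < n)%N ->
  exists2 H : 'M_n, (W <= H)%MS & (\rank H).+1 = n.
Proof.
move=> ltW; have : cokermx W != 0 by by rewrite -mxrank_eq0 mxrank_coker subn_eq0 -ltnNge.
have [[j hj] _|no] := classic (exists j, col j (cokermx W) != 0).
  exists (kermx (col j (cokermx W))).
    by rewrite sub_kermx colE mulmxA mulmx_coker mul0mx.
  rewrite mxrank_ker.
  have := rank_leq_col (col j (cokermx W)); move: hj; rewrite -mxrank_eq0; lia.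
case/negP; apply/eqP/matrixP=> i j; rewrite mxE.
have [/eqP/matrixP/(_ i 0)|h] := boolP (col j (cokermx W) == 0); first by rewrite !mxE.
by case: no; exists j.
Qed.

(** Put [s = n - \rank W] and suppose that [M t0 *m Q] has rank [s]. A member with
    [\rank (W *m M t) + s > r] could be combined with [t0] into a member of rank above [r], since
    [W *m M t] lies in the kernel of [Q]. Otherwise every hyperplane containing [W] has rank below
    [r]. *)
Lemma semi_prim_column_prop r n m (M : family n m) : card_gt K r -> linear M ->
  rank_bounded r M -> semi_prim r M -> column_prop M.
Proof.
move=> cK lM rM sM p w Q W ltW WMQ t0; rewrite ltnNge; apply/negP=> lt0.
have le0 : (\rank (M t0 *m Q) <= r)%N := leq_trans (mxrankM_maxl _ _) (rM t0).
have small t : (\rank (W *m M t) + (n - \rank W) <= r)%N.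
  rewrite leqNgt; apply/negP=> big.
  have [|||t' [h1 h2]] := @pencil_good_ranks r _ _ _ _ (fun t => W *m M t) (fun t => M t *m Q)
     (r.+1 - (n - \rank W)) (n - \rank W) t t0 cK (linear_mull W lM) (linear_mulr Q lM).
  - by rewrite /=; lia.
  - by rewrite /=; lia.
  - lia.
  have := rM t'; rewrite -(mxrank_mul_ker (M t') Q).
  have : (\rank (W *m M t') <= \rank (M t' :&: kermx Q))%N.
    by apply: mxrankS; rewrite sub_capmx submxMl sub_kermx WMQ eqxx.
  move: h1 h2 => /=; lia.
have [H WH rH] := exists_hyperplane_above ltW.
have [t ht] := sM H rH.
have := rank_mul_sub (M t) WH; have := small t; lia.
Qed.

End Families.

(** * Alternating maps *)

Section Alternating.
Variable K : fieldType.

Definition alternating d m (b : 'rV[K]_d -> 'rV[K]_d -> 'rV[K]_m) :=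
  [/\ forall u, linear (b u), forall v, linear (b^~ v) & forall v, b v v = 0].

Lemma alternating_anti d m (b : 'rV[K]_d -> 'rV[K]_d -> 'rV[K]_m) :
  alternating b -> forall u v, b u v = - b v u.
Proof.
case=> lr ll b0 u v; apply/eqP; rewrite -addr_eq0.
have := b0 (u + v); rewrite (linear_add (lr _)) !(linear_add (ll _)) !b0 add0r addr0.
by rewrite addrC => ->.
Qed.

Lemma alternating_comp d d' m (b : 'rV[K]_d -> 'rV[K]_d -> 'rV[K]_m) (H : 'M_(d', d)) :
  alternating b -> alternating (fun u v => b (u *m H) (v *m H)).
Proof.
case=> lr ll b0; split=> [u a v w|v a u w|v]; last exact: b0.
  by rewrite mulmxDl -scalemxAl lr.
by rewrite mulmxDl -scalemxAl ll.
Qed.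

Lemma alternating_mulr d m p (b : 'rV[K]_d -> 'rV[K]_d -> 'rV[K]_m) (Q : 'M_(m, p)) :
  alternating b -> alternating (fun u v => b u v *m Q).
Proof.
case=> lr ll b0; split=> [u|v|v]; [exact/linear_mulr/lr|exact/linear_mulr/ll|].
by rewrite b0 mul0mx.
Qed.

Lemma rank_nz_row d (e : 'rV[K]_d) : e != 0 -> \rank e = 1%N.
Proof. by move=> e0; rewrite rank_rV e0. Qed.

(** Split off a vector [e]: the values on a complement are handled by induction, and [b u e] spans
    at most [d - 1] dimensions because [b e e = 0]. The second half keeps any better bound known for
    the values [b u e]. *)
Lemma alternating_span d m (b : 'rV[K]_d -> 'rV[K]_d -> 'rV[K]_m) : alternating b ->
  (exists2 V : 'M_m, (\rank V <= 'C(d, 2))%N & forall u v, (b u v <= V)%MS) /\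
  (forall e p (V1 : 'M_(p, m)), e != 0 -> (forall u, (b u e <= V1)%MS) ->
   exists2 V : 'M_m, (\rank V <= \rank V1 + 'C(d.-1, 2))%N & forall u v, (b u v <= V)%MS).
Proof.
elim: d b => [|d IH] b ab.
  have b0 u v : b u v = 0.
    by case: ab => lr _ _; rewrite [v]thinmx0 (linear_zero (lr _)).
  by split=> [|e p V1 e0 _]; exists 0; rewrite ?mxrank0 // => u v; rewrite b0 sub0mx.
have split e p (V1 : 'M_(p, m)) : e != 0 -> (forall u, (b u e <= V1)%MS) ->
   exists2 V : 'M_m, (\rank V <= \rank V1 + 'C(d, 2))%N & forall u v, (b u v <= V)%MS.
  move=> e0 bV1; set H := row_base e^C%MS.
  have rH : \rank e^C%MS = d by rewrite mxrank_compl rank_nz_row ?subn1.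
  have [V' rV' bV'] : exists2 V : 'M_m, (\rank V <= 'C(d, 2))%N &
      forall u v, (b (u *m H) (v *m H) <= V)%MS.
    move: H; rewrite rH => H.
    by case: (IH _ (alternating_comp H ab)).
  have bHV u v : (u <= H)%MS -> (v <= H)%MS -> (b u v <= V')%MS.
    by move=> /submxP[u' ->] /submxP[v' ->].
  have bV1' u : (b e u <= V1)%MS by rewrite (alternating_anti ab) eqmx_opp.
  exists (V1 + V')%MS.
    have [le _] := mxrank_adds_leqif V1 V'; apply: leq_trans le _; by rewrite leq_add2l.
  have dec u : exists2 u', (u' <= H)%MS & exists a, u = u' + a *: e.
    have : (u <= H + e)%MS.
      rewrite (adds_eqmx (eq_row_base _) (eqmx_refl _)) addsmxC.
      by apply: submx_full; rewrite addsmx_compl_full.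
    case/sub_addsmxP=> -[x y] /= ->; exists (x *m H); first exact: submxMl.
    by exists (y 0 0); rewrite {1}[y]mx11_scalar mul_scalar_mx.
  move=> u v; have [u' hu [a eu]] := dec u; have [v' hv [c ->]] := dec v.
  case: ab => lr ll b0.
  rewrite (linear_add (lr _)) (linear_scale (lr _)); apply: addmx_sub; last first.
    by apply: scalemx_sub; apply: submx_trans (bV1 _) (addsmxSl _ _).
  rewrite eu (linear_add (ll _)) (linear_scale (ll _)); apply: addmx_sub.
    exact: submx_trans (bHV _ _ hu hv) (addsmxSr _ _).
  by apply: scalemx_sub; apply: submx_trans (bV1' _) (addsmxSl _ _).
split=> [|e p V1]; last exact: split.
pose e : 'rV[K]_d.+1 := delta_mx 0 0.
have e0 : e != 0.
  by apply/eqP=> /matrixP/(_ 0 0)/eqP; rewrite !mxE !eqxx oner_eq0.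
have le : linear (b^~ e) by case: ab.
have sub_e u : (b u e <= ev (b^~ e) 1%:M)%MS.
  by rewrite -[X in (X <= _)%MS]mul1mx; apply: (sub_ev le).
have [V rV bV] := split _ _ _ e0 sub_e.
exists V => //; apply: leq_trans rV _; rewrite binS bin1 addnC leq_add2l.
have /mxrankS : (e <= kermx (ev (b^~ e) 1%:M))%MS.
  by rewrite sub_kermx (mul_ev le) mul1mx; case: ab => _ _ ->.
rewrite rank_nz_row // mxrank_ker; have := rank_leq_row (ev (b^~ e) 1%:M); lia.
Qed.

(** Let [f = e a] and choose a hyperplane that contains [e] but not [f]. The values of [b] on this
    hyperplane already span everything, as if the dimension were [d - 1]. *)
Lemma alternating_span_nonscalar d m (b : 'rV[K]_d -> 'rV[K]_d -> 'rV[K]_m)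
    (a : 'M_d) (e : 'rV_d) : alternating b -> (forall v, b (v *m a) v = 0) ->
  ~~ (e *m a <= e)%MS ->
  exists2 V : 'M_m, (\rank V <= 'C(d.-1, 2))%N & forall u v, (b u v <= V)%MS.
Proof.
move=> ab ba0 nea; have [lr ll b0] := ab; have anti := alternating_anti ab.
set f := e *m a in nea *.
have ba u v : b (u *m a) v = - b (v *m a) u.
  apply/eqP; rewrite -addr_eq0; have := ba0 (u + v).
  by rewrite mulmxDl (linear_add (lr _)) !(linear_add (ll _)) !ba0 add0r addr0 addrC => ->.
have [j hj] : exists j, col j (f *m cokermx e) != 0.
  apply: NNPP => no; move: nea; rewrite submxE => /negP; apply; apply/eqP/matrixP=> i j.
  rewrite [RHS]mxE; have [/eqP/matrixP/(_ i 0)|h] := boolP (col j (f *m cokermx e) == 0).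
    by rewrite !mxE.
  by case: no; exists j.
set h := col j (cokermx e).
have fh : f *m h != 0 by move: hj; rewrite /h !colE mulmxA.
have eh : e *m h = 0 by rewrite /h colE mulmxA mulmx_coker mul0mx.
have rh : \rank h = 1%N.
  apply/eqP; rewrite eqn_leq rank_leq_col lt0n mxrank_eq0.
  by apply: contra fh => /eqP->; rewrite mulmx0.
set H := row_base (kermx h).
have rH : \rank (kermx h) = d.-1 by rewrite mxrank_ker rh subn1.
have [V rV bV] : exists2 V : 'M_m, (\rank V <= 'C(d.-1, 2))%N &
      forall u v, (b (u *m H) (v *m H) <= V)%MS.
  by rewrite -rH; case: (alternating_span (alternating_comp H ab)).
have bHV u v : u *m h = 0 -> v *m h = 0 -> (b u v <= V)%MS.
  move=> /eqP; rewrite -sub_kermx -(eq_row_base (kermx h)) => /submxP[u' ->].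
  by move=> /eqP; rewrite -sub_kermx -(eq_row_base (kermx h)) => /submxP[v' ->].
have dec u : exists u' c, u' *m h = 0 /\ u = u' + c *: f.
  set c := (u *m h) 0 0 / (f *m h) 0 0.
  exists (u - c *: f), c; rewrite subrK; split=> //.
  rewrite mulmxBl -scalemxAl [u *m h]mx11_scalar [f *m h]mx11_scalar scale_scalar_mx.
  rewrite divfK ?subrr //; apply: contra fh => /eqP fh0.
  by rewrite [f *m h]mx11_scalar fh0 raddf0.
(* Polarising [b (v a) v = 0] gives [b u f = b (u a) e]; the component of [u a] along [f]
   contributes [b (e a) e = 0], and the rest lies in the hyperplane with [e]. *)
have bf u : u *m h = 0 -> (b u f <= V)%MS.
  move=> uh; rewrite anti ba opprK.
  have [u' [c [hu' ->]]] := dec (u *m a).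
  rewrite (linear_add (ll _)) (linear_scale (ll _)) /f ba0 scaler0 addr0.
  exact: bHV.
exists V => // u v; have [u' [c [hu ->]]] := dec u; have [v' [c' [hv ->]]] := dec v.
rewrite (linear_add (lr _)) (linear_scale (lr _)) !(linear_add (ll _)) !(linear_scale (ll _)).
rewrite b0 scaler0 addr0; apply: addmx_sub; last by apply: scalemx_sub; exact: bf.
apply: addmx_sub; first exact: bHV.
by apply: scalemx_sub; rewrite anti eqmx_opp; exact: bf.
Qed.

(** The map [b^~ v] kills the plane spanned by [u] and [v], so it has rank at most 1, and a
    complement of [v] contributes ['C(2, 2)]. *)
Lemma alternating_span_dep d m (b : 'rV[K]_d -> 'rV[K]_d -> 'rV[K]_m) u v : d = 3%N ->
  alternating b -> b u v = 0 -> v != 0 -> ~~ (u <= v)%MS ->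
  exists2 V : 'M_m, (\rank V <= 2)%N & forall u v, (b u v <= V)%MS.
Proof.
move=> d3; move: b u v; rewrite d3 => b u v ab buv v0 nuv; have [_ ll b0] := ab.
have lv : linear (b^~ v) by exact: ll.
have [_ /(_ v _ (ev (b^~ v) 1%:M) v0)] := alternating_span ab.
case=> [w|V rV bV]; first by rewrite -[X in (X <= _)%MS]mul1mx; apply: (sub_ev lv).
exists V => //; apply: leq_trans rV _; rewrite addn1 ltnS.
have /mxrankS : (v + u <= kermx (ev (b^~ v) 1%:M))%MS.
  by rewrite addsmx_sub !sub_kermx !(mul_ev lv) !mul1mx buv b0 eqxx.
have : (v < v + u)%MS by rewrite /ltmx addsmxSl addsmx_sub submx_refl.
move/rank_ltmx; rewrite rank_nz_row // mxrank_ker.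
have := rank_leq_row (ev (b^~ v) 1%:M); lia.
Qed.

Lemma scalar_of_eigenvectors h p (X Y : 'M[K]_(h, p)) : row_free X ->
  (forall v : 'rV_h, (v *m Y <= v *m X)%MS) -> exists l, Y = l *: X.
Proof.
move=> fX YX.
have [Z defY] : exists Z, Y = Z *m X.
  by apply/submxP; apply/row_subP=> i; rewrite !rowE (submx_trans (YX _)) // submxMl.
have Zv (v : 'rV_h) : exists l, v *m Z = l *: v.
  apply/sub_rVP; rewrite -(submxMfree _ _ fX) -mulmxA -defY; exact: YX.
case: h => [|h] in X Y Z fX YX defY Zv *.
  by exists 0; rewrite [Y]flatmx0 [RHS]flatmx0.
have [l hl] := Zv (delta_mx 0 0); exists l.
rewrite defY -[in RHS](mul1mx X) scalemxAl; congr (_ *m _).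
apply/row_matrixP=> i; rewrite !rowE -scalemxAr mulmx1.
have [->|i0] := eqVneq i 0; first exact: hl.
have [li hi] := Zv (delta_mx 0 i); have [c] := Zv (delta_mx 0 0 + delta_mx 0 i).
rewrite mulmxDl hl hi => /matrixP e.
have := e 0 0; have := e 0 i; rewrite !mxE !eqxx (eq_sym 0 i) (negPf i0) /=.
by rewrite !mulr0 !mulr1 !addr0 !add0r => -> ->; rewrite mulr1.
Qed.

End Alternating.

(** * One-dimensional kernels *)

(** The value 2 at [r = 2], instead of 3, is what lets the recursion close at [r = 4], where
    [4 + column_bound 2] must not exceed 6. *)
Definition semi_prim_bound r := if (r <= 2)%N then r else (3 + 'C(r.-1, 2))%N.

Lemma double_bin2 n : ('C(n, 2) * 2 = n * n.-1)%N.
Proof. by elim: n => // n IH; rewrite binS bin1 mulnDl IH; case: n {IH} => //= n; lia. Qed.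

(** After expansion this is [(d - 2) (e - 2) >= 0]. *)
Lemma semi_prim_bound_split d e : (2 <= d)%N -> (2 <= e)%N ->
  (d + e + ('C(d, 2) + 'C(e, 2)) <= semi_prim_bound (d + e))%N.
Proof.
move=> d2 e2; rewrite /semi_prim_bound ifF; last by apply/negbTE; lia.
have := double_bin2 d; have := double_bin2 e; have := double_bin2 (d + e).-1.
case: d d2 => [|[|d]] // _; case: e e2 => [|[|e]] // _ /=.
rewrite !addnS !addSn /=; nia.
Qed.

Lemma semi_prim_bound_pred r : (3 <= r)%N ->
  (r + (1 + 'C(r.-2, 2)) <= semi_prim_bound r)%N.
Proof. case: r => [|[|[|r]]] // _; rewrite /semi_prim_bound /= (binS r.+1) bin1; lia. Qed.

Lemma semi_prim_bound_ge r : (r <= semi_prim_bound r)%N.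
Proof.
rewrite /semi_prim_bound; case: ifP => // h; have := double_bin2 r.-1.
case: r h => [|[|[|r]]] // _ /=; nia.
Qed.

Lemma semi_prim_bound_double r : (2 <= r)%N -> (r + r.-2 <= semi_prim_bound r)%N.
Proof.
rewrite /semi_prim_bound; case: ifP => [|h]; first by case: r => [|[|[|]]].
have := double_bin2 r.-1; case: r h => [|[|[|r]]] // _ /=; nia.
Qed.

Lemma semi_prim_bound_double5 r : (5 <= r)%N -> (r + r.-1 <= semi_prim_bound r)%N.
Proof.
move=> r5; rewrite /semi_prim_bound ifF; last by apply/negbTE; lia.
have := double_bin2 r.-1; case: r r5 => [|[|[|[|[|r]]]]] // _ /=; nia.
Qed.

(** * Ranks by fibres, and linear forms defining hyperplanes *)

Section Ranks2.
Variable K : fieldType.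

Lemma rank_le_mul_fiber p q m (A : 'M[K]_(p, m)) (B : 'M_(m, q)) :
  (\rank A <= \rank (A *m B) + \rank (kermx (A *m B) *m A))%N.
Proof.
rewrite -{1}(mxrank_mul_ker A B) leq_add2l; apply/mxrankS/row_subP=> i.
have : (row i (A :&: kermx B) <= A :&: kermx B)%MS by apply: row_sub.
rewrite sub_capmx => /andP[/submxP[u ->]]; rewrite sub_kermx -mulmxA => u0.
by apply: submxMr; rewrite sub_kermx.
Qed.

Lemma rank_row_mx_fiber p q m (X : 'M[K]_(p, q)) (Y : 'M_(p, m)) :
  (\rank (row_mx X Y) <= \rank Y + \rank (kermx Y *m X))%N.
Proof.
have := rank_le_mul_fiber (row_mx X Y) (col_mx 0 1%:M).
rewrite mul_row_col mulmx0 mulmx1 add0r mul_mx_row mulmx_ker.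
by rewrite rank_row_mx0.
Qed.

(** The form [xi] has the hyperplane [C] as kernel and [e] is a vector where it takes the value 1; a
    map that kills [C] is determined by its value at [e]. *)
Lemma exists_form n p (C : 'M[K]_(p, n)) : (\rank C).+1 = n ->
  exists (xi : 'cV_n) (e : 'rV_n), [/\ e *m xi = 1%:M,
    forall q (u : 'M_(q, n)), (u <= C)%MS = (u *m xi == 0) &
    forall q (X : 'M_(n, q)), C *m X = 0 -> X = xi *m (e *m X)].
Proof.
move=> rC; have e1 : \rank (cokermx C) = 1%N by rewrite mxrank_coker; lia.
have [X [Y [eXY fY]]] : exists X : 'M_(n, 1), exists Y : 'M_(1, n),
    X *m Y = cokermx C /\ row_free Y.
  have := mulmx_base (cokermx C); have := row_base_free (cokermx C).
  move: (col_base _) (row_base _); rewrite e1 => X Y fY e.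
  by exists X, Y.
have sub q (u : 'M_(q, n)) : (u <= C)%MS = (u *m X == 0).
  rewrite submxE -eXY mulmxA -(mul0mx _ Y).
  by apply/eqP/eqP=> [/(row_free_inj fY)|->].
have X0 : X^T != 0.
  apply/eqP=> /(congr1 trmx); rewrite trmxK trmx0 => X0.
  by move: e1; rewrite -eXY X0 mul0mx mxrank0.
have /row_freeP[Z XZ] : row_free X^T by rewrite -row_leq_rank rank_nz_row.
have eX : Z^T *m X = 1%:M by rewrite -[X]trmxK -trmx_mul XZ trmx1.
exists X, Z^T; split=> // q W CW.
have : (1%:M - X *m Z^T <= C)%MS.
  by rewrite sub mulmxBl mul1mx -mulmxA eX mulmx1 subrr.
case/submxP=> U eU; apply/eqP; rewrite -subr_eq0 mulmxA -{1}[W]mul1mx -mulmxBl eU.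
by rewrite -mulmxA CW mulmx0.
Qed.

End Ranks2.

(** * Spaces of matrices [[a, b; c, 0]] in which [c] is a single row *)

Section OneKernelVector.
Variables (K : fieldType) (k r m : nat).
Variables (a : 'rV[K]_k -> 'M[K]_r) (b : 'rV[K]_k -> 'M[K]_(r, m)) (c : 'rV[K]_k -> 'rV[K]_r).
Variable t0 : 'rV[K]_k.
Hypotheses (la : linear a) (lb : linear b) (lc : linear c).
Hypotheses (a0 : a t0 = 1%:M) (b0 : b t0 = 0) (c0 : c t0 = 0).
Hypotheses (r2 : (2 <= r)%N) (cK : card_gt K r).

(** This is [c a^j] at [t]. Below, [moment_b] expresses the pencil identities and [moment_span]
    semi-primitivity. *)
Definition moment t j := iter j (fun w => w *m a t) (c t).

Hypothesis moment_b : forall t j, moment t j *m b t = 0.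
Hypothesis moment_span : forall xi : 'cV_r, xi != 0 ->
  exists t j, moment t j *m xi != 0.

Let C := ev c 1%:M.
Let d := \rank C.

Hypothesis d2 : (2 <= d)%N.
(** It stands for the column property: modulo the products [c u *m b t], the span of the [c] and the
    kernel vector are killed, leaving rank at most [r - d - 1]. *)
Hypothesis rank_mod : (d < r)%N -> forall p (Q : 'M_(m, p)),
  (forall u t, c u *m b t *m Q = 0) -> forall x, (\rank (ev b x *m Q) <= 'C(r - d, 2))%N.

Let mulC t : t *m C = c t.
Proof. by rewrite (mul_ev lc) mul1mx. Qed.

Let c_sub t : (c t <= C)%MS.
Proof. by rewrite -mulC submxMl. Qed.

Let c_surj u : (u <= C)%MS -> exists t, u = c t.
Proof. by case/submxP=> t ->; exists t; rewrite mulC. Qed.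

Let cb u : c u *m b u = 0.
Proof. exact: (moment_b u 0). Qed.

Let cb_anti u t : c u *m b t = - (c t *m b u).
Proof.
apply/eqP; rewrite -addr_eq0; have := cb (u + t).
by rewrite (linear_add lb) (linear_add lc) mulmxDl !mulmxDr !cb add0r addr0 => ->.
Qed.

Let cb_stab N u : c N = 0 -> c u *m b N = 0.
Proof. by move=> cN; rewrite cb_anti cN mul0mx oppr0. Qed.

Let D := row_base C.
Let lift (v : 'rV_d) : 'rV_k := v *m (D *m pinvmx C).
Let c_lift v : c (lift v) = v *m D.
Proof. by rewrite -mulC /lift -mulmxA mulmxKpV // eq_row_base. Qed.

(** By [cb_stab], the product [c u *m b t] depends on [t] only through [c t]; [beta] is the
    resulting map in coordinates on the span [D] of the [c]. *)
Let beta (v w : 'rV_d) := v *m D *m b (lift w).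

Let alt_beta : alternating beta.
Proof.
split=> [u x v w|v x u w|v]; last by rewrite /beta -c_lift cb.
  by rewrite /beta /lift mulmxDl -scalemxAl lb mulmxDr scalemxAr.
by rewrite /beta !mulmxDl -!scalemxAl.
Qed.

Let in_D t : exists v, c t = v *m D.
Proof. by apply/submxP; rewrite eq_row_base. Qed.

Let beta_eq u t v w : c u = v *m D -> c t = w *m D -> c u *m b t = beta v w.
Proof.
move=> cu ct; rewrite /beta -cu; apply/eqP; rewrite -subr_eq0 -mulmxBr.
rewrite -(linear_opp lb) -(linear_add lb) cb_stab //.
by rewrite (linear_add lc) (linear_opp lc) c_lift ct subrr.
Qed.

Let rank_b_mod p (Q : 'M_(m, p)) x : (d < r)%N -> (forall v w, beta v w *m Q = 0) ->
  (\rank (ev b x *m Q) <= 'C(r - d, 2))%N.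
Proof.
move=> dr bQ; apply: rank_mod => // u t.
by have [v cu] := in_D u; have [w ct] := in_D t; rewrite (beta_eq cu ct) bQ.
Qed.

Let rank_b x q (V : 'M_(q, m)) : (d < r)%N -> (forall v w, (beta v w <= V)%MS) ->
  (\rank (ev b x) <= 'C(r - d, 2) + \rank V)%N.
Proof.
move=> dr bV; apply: leq_trans (rank_le_mul_coker _ V) _; rewrite leq_add2r.
by apply: rank_b_mod => // v w; apply/eqP; rewrite -submxE.
Qed.

(** Both identities are coefficients in [l] of [c a b = 0] evaluated at [l N + u]. *)
Let moment2 N u : c N = 0 ->
  c u *m a N *m b N = 0 /\ c u *m a N *m b u = - (c u *m a u *m b N).
Proof.
move=> cN.
have eq l : l *: (c u *m a N *m b u + c u *m a u *m b N) +
            (l * l) *: (c u *m a N *m b N) = 0.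
  have cab : c u *m a u *m b u = 0 := moment_b u 1.
  have := moment_b (l *: N + u) 1; rewrite /moment /= la lb lc cN scaler0 add0r.
  rewrite !mulmxDr !mulmxDl cab addr0 -!scalemxAr -!scalemxAl scalerA => e.
  by rewrite -[RHS]e [RHS]addrC [X in _ = _ + X]addrC scalerDr addrA.
(* Separating the coefficients of [l] and [l^2] takes two distinct nonzero scalars; the field has
   more than [r >= 2] elements. *)
have [l l0 l1] : exists2 l : K, l != 0 & l != 1.
  have [s [us ss]] := cK; apply: NNPP => no.
  have /(uniq_leq_size us) : {subset s <= [:: 0; 1]}.
    move=> l ls; rewrite !inE; apply/negPn/negP; rewrite negb_or => /andP[l0 l1].
    by apply: no; exists l.
  by rewrite leqNgt (leq_trans _ ss).
have e1 := eq 1; rewrite mulr1 !scale1r in e1.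
have /eqP qs := e1; rewrite addr_eq0 in qs; move/eqP in qs.
have := eq l; rewrite {}qs scalerN addrC -scalerBl -{3}[l]mulr1 -mulrBr => /eqP.
rewrite scaler_eq0 mulf_eq0 (negPf l0) subr_eq0 (negPf l1) /= => /eqP X2.
split=> //; apply/eqP; rewrite -addr_eq0.
by move: e1; rewrite X2 addr0 => ->.
Qed.

Let bound x1 x2 n : (\rank (ev b x1) <= n)%N -> (r + n <= semi_prim_bound r)%N ->
  (\rank (row_mx (ev a x1 + ev c x2)%R (ev b x1)) <= semi_prim_bound r)%N.
Proof.
move=> rb; apply: leq_trans; apply: leq_trans (rank_row_mx_fiber _ _) _.
rewrite addnC leq_add //; apply: leq_trans (rank_leq_col _) _ => //.
Qed.

(** Each step from [i] to [i + 1] changes only by [moment t i *m xi *m v], which vanishes as long as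
    [xi] kills the earlier moments. *)
Let moment_shift N t j (xi : 'cV_r) (v : 'rV_r) : c N = 0 -> a N = xi *m v ->
  (forall i, (i < j)%N -> moment t i *m xi = 0) -> moment (t + N) j = moment t j.
Proof.
move=> cN aN; elim: j => [|j IH] h.
  by rewrite /moment /= (linear_add lc) cN addr0.
rewrite /moment !iterS -/(moment (t + N) j) -/(moment t j) IH; last first.
  by move=> i ij; apply: h; apply: ltnW.
by rewrite (linear_add la) aN mulmxDr mulmxA h // mul0mx addr0.
Qed.

Let first_moment (xi : 'cV_r) : xi != 0 -> exists t j, moment t j *m xi != 0 /\
  forall i, (i < j)%N -> moment t i *m xi = 0.
Proof.
move=> /moment_span[t [j hj]].
have ex : exists j, moment t j *m xi != 0 by exists j.
exists t, (ex_minn ex); case: ex_minnP => n hn hmin; split=> // i lt.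
by apply/eqP/negPn/negP => /hmin; rewrite leqNgt lt.
Qed.

Let bound_generic x1 x2 : (d < r)%N ->
  (r + ('C(d, 2) + 'C(r - d, 2)) <= semi_prim_bound r)%N ->
  (\rank (row_mx (ev a x1 + ev c x2)%R (ev b x1)) <= semi_prim_bound r)%N.
Proof.
move=> dr; apply: bound; have [[V rV bV] _] := alternating_span alt_beta.
by apply: leq_trans (rank_b x1 dr bV) _; rewrite addnC leq_add2r.
Qed.

(** Now [b t] depends only on [c t], and [x1 = c t1]. Unless [ev b x1] has rank at most [r - 2], its
    rank is [r - 1] and [x1 *m b t = 0] only for [c t] in the line of [x1]. *)
Let bound_full x1 x2 : d = r ->
  (\rank (row_mx (ev a x1 + ev c x2)%R (ev b x1)) <= semi_prim_bound r)%N.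
Proof.
move=> dr; have fC : row_full C by rewrite -col_leq_rank -/d dr.
have bN N : c N = 0 -> b N = 0.
  move=> cN; apply: (row_full_inj fC); rewrite mulmx0; apply/row_matrixP=> i.
  by rewrite row_mul rowE mulC cb_stab // row0.
have [le|ge] := leqP (\rank (ev b x1)) r.-2.
  exact: bound le (semi_prim_bound_double r2).
have mulE t : t *m ev b x1 = x1 *m b t by rewrite (mul_ev lb).
have [t1 x1E] : exists t, x1 = c t by apply/c_surj/submx_full.
have x10 : x1 != 0.
  apply: contraTneq ge => x10; suff -> : ev b x1 = 0 by rewrite mxrank0.
  by apply/row_matrixP=> i; rewrite rowE mulE x10 mul0mx row0.
set E := ev b x1 in mulE ge *.
have kerCE : (kermx C <= kermx E)%MS.
  apply/row_subP=> i; rewrite sub_kermx mulE bN ?mulmx0 //.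
  by rewrite -mulC -row_mul mulmx_ker row0.
have x1k : (x1 <= kermx E *m C)%MS.
  by rewrite {1}x1E -mulC submxMr // sub_kermx mulE {1}x1E cb.
have rk : \rank (kermx E *m C) = (r - \rank E)%N.
  have := mxrank_mul_ker (kermx E) C; rewrite (capmx_idPr kerCE) !mxrank_ker -/d dr.
  have := rank_leq_row C; rewrite -/d dr; have := rank_leq_row E; lia.
have r1 : \rank x1 = 1%N by rewrite rank_nz_row.
have rE : (\rank E <= r.-1)%N by have := mxrankS x1k; rewrite r1 rk; lia.
have kx1 : (kermx E *m C <= x1)%MS.
  by rewrite -(geq_leqif (mxrank_leqif_sup x1k)) r1 rk; lia.
have ker_t1 (y : 'rV_r) : y *m b t1 = 0 -> (y <= x1)%MS.
  have [w ->] : exists t, y = c t by apply/c_surj/submx_full.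
  rewrite cb_anti -x1E -mulE => /eqP; rewrite oppr_eq0 -sub_kermx => h.
  by rewrite -mulC; apply: submx_trans kx1; apply: submxMr.
(* For such [t], the identity [c a b = 0] at [t1 + (t - l t1)] gives [x1 *m a t *m b t1 = 0], and
   the kernel of [b t1] is the line of [x1]. The fibre thus adds one dimension to [r - 1]. *)
have fib : (kermx E *m (ev a x1 + ev c x2) <= x1)%MS.
  apply/row_subP=> i; rewrite row_mul; set t := row i _.
  have ct : (c t <= x1)%MS.
    by rewrite -mulC; apply: submx_trans kx1; apply/submxMr/row_sub.
  rewrite mulmxDr (mul_ev la) (mul_ev lc); apply: addmx_sub; last first.
    exact: submx_trans (submxMl _ _) ct.
  apply: ker_t1; case/sub_rVP: ct => l ct.
  have cN : c (t - l *: t1) = 0.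
    by rewrite (linear_add lc) (linear_opp lc) (linear_scale lc) ct -x1E subrr.
  have := moment_b (t1 + (t - l *: t1)) 1; rewrite /moment /= (linear_add lc) cN addr0.
  rewrite (linear_add lb) (bN _ cN) addr0 (linear_add la) mulmxDr mulmxDl.
  rewrite (moment_b t1 1) add0r (linear_add la) (linear_opp la) (linear_scale la).
  rewrite mulmxDr mulmxN -scalemxAr mulmxDl mulNmx -scalemxAl (moment_b t1 1) scaler0 oppr0 addr0.
  by rewrite -x1E.
apply: leq_trans (semi_prim_bound_ge r); apply: leq_trans (rank_row_mx_fiber _ _) _.
by have := mxrankS fib; rewrite r1 -/E; lia.
Qed.

(* Here [D] is a hyperplane of [K^r] and [b N] is a nonzero rank 1 matrix [xi *m w] vanishing on [D]:
   either [a N] is scalar on [D], which gives a rank 1 member of the space and contradicts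
   semi-primitivity, or [beta] modulo [w] has many zeros. *)
Let bound_stab x1 x2 N : d.+1 = r -> c N = 0 -> b N != 0 ->
  (\rank (row_mx (ev a x1 + ev c x2)%R (ev b x1)) <= semi_prim_bound r)%N.
Proof.
move=> dr cN bN0; have [xi [e [exi subC facC]]] := exists_form dr.
have CbN : C *m b N = 0.
  by apply/row_matrixP=> i; rewrite row_mul rowE mulC cb_stab // row0.
set w := e *m b N; have bN : b N = xi *m w := facC _ _ CbN.
have w0 : w != 0 by apply: contra bN0 => /eqP h; rewrite bN h mulmx0.
have xi0 : xi != 0 by apply: contra bN0 => /eqP h; rewrite bN h mul0mx.
have scal_w (s : 'M_1) : s *m w = 0 -> s = 0.
  rewrite [s]mx11_scalar mul_scalar_mx => /eqP; rewrite scaler_eq0 (negPf w0) orbF => /eqP->.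
  exact: raddf0.
have DaN : (D *m a N <= D)%MS.
  rewrite /D eq_row_base -/D; apply/row_subP=> i; rewrite subC; apply/eqP/scal_w.
  have [u cu] : exists t, row i D = c t.
    by apply/c_surj; rewrite (submx_trans (row_sub _ _)) // eq_row_base.
  by have [+ _] := moment2 u cN; rewrite bN row_mul cu !mulmxA.
have [ad ead] := submxP DaN.
have [sc|/not_all_ex_not[f nf]] := classic (forall v : 'rV_d, (v *m (D *m a N) <= v *m D)%MS).
  (* Subtracting [l t0] makes [a] vanish on [D], so that [a N' = xi *m v] and [b N' = xi *m w].
     Shifting [t] by [N'] then breaks the moment identity at the first moment not killed by [xi]. *)
  have [l hl] := scalar_of_eigenvectors (row_base_free C) sc.
  have cN' : c (N - l *: t0) = 0.
    by rewrite (linear_add lc) (linear_opp lc) (linear_scale lc) cN c0 scaler0 subrr.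
  have bN' : b (N - l *: t0) = b N.
    by rewrite (linear_add lb) (linear_opp lb) (linear_scale lb) b0 scaler0 subr0.
  have CaN' : C *m a (N - l *: t0) = 0.
    apply/eqP; rewrite -submx0 -(eqmxMr _ (eq_row_base C)) submx0.
    rewrite (linear_add la) (linear_opp la) (linear_scale la) a0 mulmxDr hl.
    by rewrite mulmxN -scalemxAr mulmx1 subrr.
  have aN' := facC _ _ CaN'.
  have [t [j [hj min]]] := first_moment xi0.
  have := moment_b (t + (N - l *: t0)) j.
  rewrite (moment_shift cN' aN' min) (linear_add lb) mulmxDr moment_b add0r bN' bN mulmxA.
  by move/scal_w => h; rewrite h eqxx in hj.
(* Modulo [w], [beta (v a) v = 0] with [a] not scalar, so [beta] spans only ['C(d.-1, 2)] dimensions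
   there. *)
have nad : ~~ (f *m ad <= f)%MS.
  by apply/negP=> h; apply: nf; rewrite ead mulmxA submxMr.
have bad v : beta (v *m ad) v *m cokermx w = 0.
  apply/eqP; rewrite -submxE /beta -(mulmxA v) -ead mulmxA -c_lift.
  by have [_ ->] := moment2 (lift v) cN; rewrite bN mulmxA eqmx_opp submxMl.
have [V rV bV] := alternating_span_nonscalar (alternating_mulr (cokermx w) alt_beta) bad nad.
apply: (@bound _ _ (1 + 'C(r.-2, 2))%N); last by apply: semi_prim_bound_pred; lia.
apply: leq_trans (rank_le_mul_coker _ w) _; rewrite rank_nz_row // addnC leq_add2l.
apply: leq_trans (rank_le_mul_coker _ V) _; rewrite -mulmxA.
have := @rank_b_mod _ (cokermx w *m cokermx V) x1.
have -> : 'C(r - d, 2) = 0%N by have -> : (r - d = 1)%N by lia.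
have -> : (r.-2 = d.-1)%N by lia.
move=> rb; have rb' : (\rank (ev b x1 *m (cokermx w *m cokermx V)) <= 0)%N.
  by apply: rb => [|u v]; [lia|apply/eqP; rewrite mulmxA -submxE].
by have := leq_add rb' rV; rewrite add0n.
Qed.

(* Here the other bounds are off by one.  If [beta u v = 0] only for dependent [u] and [v], the
   [a N] with [c N = 0] are scalar on [D]; were the bound not to hold, they would otherwise be
   arbitrary on [x1], and then some [b t] with [c t != 0] would have rank 1. *)
Let bound_four x1 x2 : r = 4%N -> d = 3%N -> (forall N, c N = 0 -> b N = 0) ->
  (\rank (row_mx (ev a x1 + ev c x2)%R (ev b x1)) <= semi_prim_bound r)%N.
Proof.
move=> r4 d3 bN; have dr : d.+1 = r by rewrite d3.
have six : semi_prim_bound r = 6%N by rewrite r4.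
have le2 n : (n <= 2)%N -> (r + n <= semi_prim_bound r)%N by rewrite six; lia.
have [[V [rV bV]]|noV] := classic (exists V : 'M_m, (\rank V <= 2)%N /\ forall v w, (beta v w <= V)%MS).
  apply: (@bound _ _ (\rank V)); last exact: le2.
  have dr' : (d < r)%N by lia.
  have := rank_b x1 dr' bV; have -> : 'C(r - d, 2) = 0%N by have -> : (r - d = 1)%N by lia.
  by [].
have indep v w : w != 0 -> beta v w = 0 -> (v <= w)%MS.
  move=> w0 bvw; apply/negPn/negP => nvw; apply: noV.
  by have [V rV bV] := alternating_span_dep d3 alt_beta bvw w0 nvw; exists V.
have [le|ge] := leqP (\rank (ev b x1)) 2; first exact: bound le (le2 _ (leqnn 2)).
have mulE t : t *m ev b x1 = x1 *m b t by rewrite (mul_ev lb).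
set E := ev b x1 in mulE ge *.
have kerCE : (kermx C <= kermx E)%MS.
  apply/row_subP=> i; rewrite sub_kermx mulE bN ?mulmx0 //.
  by rewrite -mulC -row_mul mulmx_ker row0.
have rE : (\rank E <= 3)%N.
  have := mxrankS kerCE; rewrite !mxrank_ker -/d d3.
  have := rank_leq_row C; rewrite -/d d3; have := rank_leq_row E; lia.
have kerEC : (kermx E <= kermx C)%MS.
  by rewrite -(geq_leqif (mxrank_leqif_sup kerCE)) !mxrank_ker -/d d3 leq_sub2l.
(* In the remaining case [ev b x1] has rank 3 and the same kernel as [C]; in particular [x1] cannot
   lie in [D]. *)
have cE t : x1 *m b t = 0 -> c t = 0.
  rewrite -mulE -mulC => /eqP; rewrite -sub_kermx => h; apply/eqP.
  by rewrite -sub_kermx (submx_trans h).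
have [xi [e0 [exi subC facC]]] := exists_form dr.
have x1C : x1 *m xi != 0.
  apply/negP=> h; have /c_surj[u x1u] : (x1 <= C)%MS by rewrite subC.
  have cu : c u = 0 by apply: cE; rewrite x1u cb.
  move: ge; suff -> : E = 0 by rewrite mxrank0.
  by apply/row_matrixP=> i; rewrite rowE mulE x1u cu mul0mx row0.
have Dxi : D *m xi = 0 by apply/eqP; rewrite -subC eq_row_base.
have shift N l : c N = 0 -> c (N - l *: t0) = 0 /\ a (N - l *: t0) = a N - l%:M.
  move=> cN; rewrite (linear_add lc) (linear_opp lc) (linear_scale lc) cN c0 scaler0 subrr.
  by rewrite (linear_add la) (linear_opp la) (linear_scale la) a0 scalemx1.
have scal N : c N = 0 -> exists l, D *m a N = l *: D.
  (* [H] consists of the [v] whose image under [a N] stays in [D], a subspace of codimension at most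
     1. There [moment2] gives [beta (v a) v = 0], so every [v] is an eigenvector. *)
  move=> cN; set H := kermx (D *m a N *m xi).
  have onH (v : 'rV_d) : (v <= H)%MS -> (v *m (D *m a N) <= v *m D)%MS.
    move=> vH; have [->|v0] := eqVneq v 0; first by rewrite mul0mx sub0mx.
    have : (v *m (D *m a N) <= D)%MS.
      by rewrite /D eq_row_base -/D subC -mulmxA -sub_kermx.
    case/submxP=> v' ev'; rewrite ev'; apply: submxMr; apply: indep => //.
    rewrite /beta -ev' mulmxA -c_lift.
    by have [_ ->] := moment2 (lift v) cN; rewrite bN // mulmx0 oppr0.
  have free : row_free (row_base H *m D).
    by rewrite /row_free mxrankMfree ?row_base_free // eq_row_base.
  have [v|l hl] := scalar_of_eigenvectors (Y := row_base H *m (D *m a N)) free.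
    rewrite (mulmxA v (row_base H) (D *m a N)) (mulmxA v (row_base H) D); apply: onH.
    by apply: submx_trans (submxMl _ _) _; rewrite eq_row_base.
  have [cN' aN'] := shift N l cN; set N' := N - l *: t0 in cN' aN'.
  have [z|nz] := eqVneq (D *m a N') 0.
    by exists l; move: z; rewrite aN' mulmxBr mul_mx_scalar => /eqP; rewrite subr_eq0 => /eqP.
  have HDaN : row_base H *m (D *m a N') = 0.
    by rewrite aN' mulmxBr mul_mx_scalar mulmxBr hl -scalemxAr subrr.
  have [f /submxP[e ef] f0] := rowV0Pn nz.
  have bN' : b N' = 0 by apply: bN.
  have q u : c u *m a N' *m b u = 0.
    by have [_ ->] := moment2 u cN'; rewrite bN' mulmx0 oppr0.
  have pol u v : c u *m a N' *m b v = - (c v *m a N' *m b u).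
    apply/eqP; rewrite -addr_eq0; have := q (u + v).
    by rewrite (linear_add lc) (linear_add lb) !mulmxDl !mulmxDr !q add0r addr0 => ->.
  have neH : ~~ (e <= row_base H)%MS.
    by apply/negP => /submxP[y ey]; move: f0; rewrite ef ey -mulmxA HDaN mulmx0 eqxx.
  have full : row_full (row_base H + e)%MS.
    have : (row_base H < row_base H + e)%MS by rewrite /ltmx addsmxSl addsmx_sub submx_refl.
    have rH : \rank (row_base H) = (d - \rank (D *m a N *m xi))%N.
      by rewrite eq_row_base mxrank_ker.
    move/rank_ltmx; rewrite -col_leq_rank.
    have := rank_leq_col (D *m a N *m xi); lia.
  have cf : c (lift e) *m a N' = f by rewrite c_lift ef mulmxA.
  (* [a N'] kills [H] and maps [D] onto the line of [f], which is not in [D]. Once [f] is killed by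
     every [b u], the row [x1] can be replaced by its projection [c u] to [D] along [f]; then
     [x1 *m b u = 0] forces [c u = 0], hence [E = 0]. *)
  have fb u : f *m b u = 0.
    have [v cu] := in_D u.
    have /sub_addsmxP[[x y] /= ev'] : (v <= row_base H + e)%MS by apply: submx_full.
    have vf : v *m D *m a N' = y *m f.
      by rewrite -(mulmxA v) ev' mulmxDl -(mulmxA x) HDaN mulmx0 add0r -(mulmxA y) -ef.
    by rewrite -cf pol cu vf -mulmxA -cf q mulmx0 oppr0.
  have fxi : f *m xi != 0.
    apply: contra neH; rewrite eq_row_base sub_kermx ef aN' mulmxBr mul_mx_scalar -(mulmxA e).
    by rewrite mulmxBl -scalemxAl Dxi scaler0 subr0.
  have [sx hx] : exists l, x1 *m xi = l%:M by exists ((x1 *m xi) 0 0); exact: mx11_scalar.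
  have [sf hf] : exists l, f *m xi = l%:M by exists ((f *m xi) 0 0); exact: mx11_scalar.
  have sf0 : sf != 0 by apply: contra fxi => /eqP h; rewrite hf h raddf0.
  have [u cu] : exists u, x1 - (sx / sf) *: f = c u.
    by apply: c_surj; rewrite subC mulmxBl -scalemxAl hx hf scale_scalar_mx divfK // subrr.
  have x1b t : x1 *m b t = c u *m b t.
    by rewrite -cu mulmxBl -scalemxAl fb scaler0 subr0.
  have cu0 : c u = 0 by apply: cE; rewrite x1b cb.
  move: ge; suff -> : E = 0 by rewrite mxrank0.
  by apply/row_matrixP=> i; rewrite rowE mulE x1b cu0 mul0mx row0.
apply: leq_trans (rank_row_mx_fiber _ _) _; rewrite -/E six.
set F := kermx E *m _.
have [le|gt] := leqP (\rank F) 3; first exact: leq_add rE le.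
have fF : row_full F by rewrite -col_leq_rank (leq_trans _ gt) ?r4.
have xi0 : xi != 0 by apply: contra x1C => /eqP->; rewrite mulmx0.
have [t [j [hj min]]] := first_moment xi0.
have ct : c t != 0.
  apply: contra hj => /eqP ct; suff -> : moment t j = 0 by rewrite mul0mx.
  by elim: (j) => [|i IH] //; rewrite /moment iterS -/(moment t i) IH mul0mx.
(* As the fibre [F] is everything, [y = x1 *m a u] with [c u = 0]. Subtracting the scalar [l] leaves
   [a N = xi *m v], and the identity of index [j.+1] at [t + N] gives [v *m b t = 0]. *)
have yb (y : 'rV_r) : (y *m b t <= x1 *m b t)%MS.
  have /submxP[s ys] : (y <= F)%MS by apply: submx_full.
  set u := s *m kermx E.
  have x1bu : x1 *m b u = 0 by rewrite -mulE /u -mulmxA mulmx_ker mulmx0.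
  have cu := cE _ x1bu.
  have yu : y = x1 *m a u.
    by rewrite ys /F mulmxA -/u mulmxDr (mul_ev la) (mul_ev lc) cu mulmx0 addr0.
  have [l hl] := scal u cu; have [cN aN] := shift u l cu.
  set N := u - l *: t0 in cN aN.
  have CaN : C *m a N = 0.
    apply/eqP; rewrite -submx0 -(eqmxMr _ (eq_row_base C)) submx0 -/D.
    by rewrite aN mulmxBr mul_mx_scalar hl subrr.
  have := facC _ _ CaN; set v := e0 *m a N => aNv.
  have vb : v *m b t = 0.
    have := moment_b (t + N) j.+1; rewrite {1}/moment iterS -/(moment (t + N) j).
    rewrite (moment_shift cN aNv min) (linear_add la) (linear_add lb) (bN _ cN) addr0 aNv.
    rewrite mulmxDr mulmxDl [X in X + _](moment_b t j.+1) add0r mulmxA.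
    rewrite [moment t j *m xi]mx11_scalar mul_scalar_mx -scalemxAl => /eqP.
    rewrite scaler_eq0 => /orP[/eqP h|/eqP //].
    by move: hj; rewrite [moment t j *m xi]mx11_scalar h raddf0 eqxx.
  have : x1 *m a N *m b t = 0 by rewrite aNv mulmxA -mulmxA vb mulmx0.
  rewrite aN mulmxBr mul_mx_scalar -yu mulmxBl => /eqP; rewrite subr_eq0 => /eqP->.
  by rewrite -scalemxAl scalemx_sub.
have [w cw] := in_D t.
have w0 : w != 0 by apply: contra ct => /eqP h; rewrite cw h mul0mx.
have blift : b (lift w) = b t.
  apply/eqP; rewrite -subr_eq0 -(linear_opp lb) -(linear_add lb) bN //.
  by rewrite (linear_add lc) (linear_opp lc) c_lift cw subrr.
(* By [indep] the kernel on [D] is at most a line, so [D *m b t] has rank at least 2, while [yb]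
   makes it at most 1. *)
have /mxrankS : (kermx (D *m b t) <= w)%MS.
  apply/row_subP=> i; apply: indep => //; rewrite /beta blift -mulmxA.
  by rewrite -row_mul mulmx_ker row0.
have /mxrankS : (D *m b t <= x1 *m b t)%MS.
  by apply/row_subP=> i; rewrite row_mul yb.
rewrite mxrank_ker; have := rank_leq_row (x1 *m b t); have := rank_leq_row w.
by move: d3; rewrite /d; lia.
Qed.

(** The bounded matrix describes the image at the vector with coordinates [x1] and [x2]. The cases
    are [d = r], [d <= r - 2], and [d = r - 1]; in the last one, if [b] vanishes wherever [c] does,
    then [ev b x1] has rank at most [d], which suffices from [r = 5] on. *)
Theorem one_kernel_vector_bound x1 x2 :
  (\rank (row_mx (ev a x1 + ev c x2)%R (ev b x1)) <= semi_prim_bound r)%N.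
Proof.
have dr : (d <= r)%N := rank_leq_col C.
have [|lt] := eqVneq d r; first exact: bound_full.
have {lt}dr : (d < r)%N by rewrite ltn_neqAle lt.
have [e|lt] := eqVneq d.+1 r; last first.
  apply: bound_generic => //.
  have := semi_prim_bound_split d2 (_ : 2 <= r - d)%N; rewrite subnKC //; last exact: ltnW.
  by apply; lia.
have [[N [cN bN]]|no] := classic (exists N, c N = 0 /\ b N != 0).
  exact: bound_stab e cN bN.
have bN N : c N = 0 -> b N = 0.
  by move=> cN; apply/eqP/negPn/negP=> h; apply: no; exists N.
have [r5|r5] := leqP 5 r.
  apply: bound (semi_prim_bound_double5 r5); have -> : r.-1 = d by rewrite -e.
  have /mxrankS : (kermx C <= kermx (ev b x1))%MS.
    apply/row_subP=> i; rewrite sub_kermx (mul_ev lb) bN ?mulmx0 //.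
    by rewrite -mulC -row_mul mulmx_ker row0.
  rewrite !mxrank_ker -/d; have := rank_leq_row C; rewrite -/d.
  have := rank_leq_row (ev b x1); lia.
have [r4|r3] := eqVneq r 4%N; first by apply: bound_four => //; lia.
have {r3 r5}r3 : r = 3%N by lia.
by apply: bound_generic => //; have -> : d = 2%N by [lia]; rewrite r3.
Qed.

End OneKernelVector.

(** * Spaces of rank one and Krylov subspaces *)

Section RankOne.
Variable K : fieldType.

(** [W] is spanned by the iterates of [c] preceding one that depends on the earlier ones; such an
    iterate exists by dimension. *)
Lemma krylov r (a : 'M[K]_r) (c : 'rV_r) : exists W : 'M_r,
  [/\ (c <= W)%MS, (W *m a <= W)%MS & forall p (X : 'M_(r, p)),
    (forall j, iter j (fun w => w *m a) c *m X = 0) -> W *m X = 0].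
Proof.
pose w j := iter j (fun w => w *m a) c.
pose W i : 'M_r := (\sum_(j < i) <<w j>>)%MS.
have wW j i : (j < i)%N -> (w j <= W i)%MS.
  by move=> ji; apply: (sumsmx_sup (Ordinal ji)); rewrite ?genmxE.
have [i hi] : exists i, (w i <= W i)%MS.
  apply: NNPP => no; have : (r < \rank (W r.+1))%N; last first.
    by rewrite ltnNge rank_leq_row.
  elim: r.+1 => [|i IH] //; apply: leq_ltn_trans IH _; apply: rank_ltmx.
  rewrite /ltmx; apply/andP; split.
    by apply/sumsmx_subP=> j _; rewrite genmxE wW // (leq_trans (ltn_ord j)).
  apply/negP=> h; apply: no; exists i; apply: submx_trans h; exact: wW.
exists (W i); split.
- by case: i hi => [//|i _]; exact: (wW 0).
- rewrite sumsmxMr_gen; apply/sumsmx_subP=> j _; rewrite genmxE.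
  rewrite (submx_trans (submxMr _ (_ : _ <= w j)%MS)) ?genmxE //.
  have [ji|ij] := ltnP j.+1 i; first exact: (wW j.+1).
  have e : j.+1 = i by apply/eqP; rewrite eqn_leq ij ltn_ord.
  suff : (w j.+1 <= W i)%MS by []; by rewrite e.
move=> p X wX; apply/eqP; rewrite -submx0 sumsmxMr_gen; apply/sumsmx_subP=> j _.
by rewrite genmxE submx0 -submx0 (submx_trans (submxMr _ (_ : _ <= w j)%MS)) ?genmxE // wX sub0mx.
Qed.

Lemma rank_one_factor p m (X : 'M[K]_(p, m)) : (\rank X <= 1)%N ->
  exists (f : 'cV_p) (g : 'rV_m), X = f *m g.
Proof.
case: (posnP (\rank X)) => [/eqP|h le1].
  by rewrite mxrank_eq0 => /eqP-> _; exists 0, 0; rewrite mul0mx.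
have e : \rank X = 1%N by lia.
have := mulmx_base X; move: (col_base X) (row_base X); rewrite e => f g <-.
by exists f, g.
Qed.

Lemma rank_one_sum_col p m (f f2 : 'cV[K]_p) (g g2 : 'rV_m) : g != 0 -> ~~ (g2 <= g)%MS ->
  f2 != 0 -> (\rank (f *m g + f2 *m g2)%R <= 1)%N -> exists l, f = l *: f2.
Proof.
move=> g0 ng f20; rewrite -mul_row_col mxrankMfree; last first.
  have : (g < g + g2)%MS by rewrite /ltmx addsmxSl addsmx_sub submx_refl.
  by rewrite -row_leq_rank -addsmxE => /rank_ltmx; rewrite rank_nz_row.
rewrite -mxrank_tr tr_row_mx => le1.
have f2t0 : f2^T != 0 by apply: contra f20 => /eqP/(congr1 trmx); rewrite trmxK trmx0 => ->.
have sub : (f2^T <= col_mx f^T f2^T)%MS by rewrite -addsmxE addsmxSr.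
have : (col_mx f^T f2^T <= f2^T)%MS.
  by rewrite -(geq_leqif (mxrank_leqif_sup sub)) rank_nz_row.
rewrite -addsmxE addsmx_sub => /andP[/sub_rVP[l /(congr1 trmx)]].
by rewrite trmxK linearZ /= trmxK; exists l.
Qed.

(** Two members with independent row factors must have proportional column factors, otherwise their
    sum has rank 2. Hence one member outside the line [g1] fixes the column of all the others. *)
Lemma rank_one_family k p m (C : 'rV[K]_k -> 'M[K]_(p, m)) : linear C ->
  (forall t, \rank (C t) <= 1)%N ->
  (exists g : 'rV_m, forall t, (C t <= g)%MS) \/
  (exists f : 'cV_p, forall t, exists g, C t = f *m g).
Proof.
move=> lC C1.
have [[t1 C10]|no] := classic (exists t, C t != 0); last first.
  left; exists 0 => t; suff -> : C t = 0 by rewrite sub0mx.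
  by apply/eqP/negPn/negP => h; apply: no; exists t.
have [f1 [g1 e1]] := rank_one_factor (C1 t1).
have [|/not_all_ex_not[t2 /negP n2]] := classic (forall t, (C t <= g1)%MS); first by left; exists g1.
right.
have [f2 [g2 e2]] := rank_one_factor (C1 t2).
have g10 : g1 != 0 by apply: contra C10 => /eqP h; rewrite e1 h mulmx0.
have ng (f : 'cV_p) g : ~~ (f *m g <= g1)%MS -> f != 0 /\ ~~ (g <= g1)%MS.
  move=> h; split; first by apply: contra h => /eqP->; rewrite mul0mx sub0mx.
  by apply: contra h; apply: submx_trans; exact: submxMl.
have [f20 ng2] : f2 != 0 /\ ~~ (g2 <= g1)%MS by apply: ng; rewrite -e2.
exists f2 => t; have [/submxP[f ef]|] := boolP (C t <= g1)%MS.
  have [l fl] : exists l, f = l *: f2.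
    by apply: (rank_one_sum_col g10 ng2 f20); rewrite -ef -e2 -(linear_add lC).
  by rewrite ef fl; exists (l *: g1); rewrite -scalemxAr scalemxAl.
have [f [g ef]] := rank_one_factor (C1 t); rewrite ef => /ng[f0 ngg].
have [l fl] : exists l, f1 = l *: f.
  by apply: (rank_one_sum_col g10 ngg f0); rewrite -ef -e1 -(linear_add lC).
have [l2 fl2] : exists l, f1 = l *: f2.
  by apply: (rank_one_sum_col g10 ng2 f20); rewrite -e2 -e1 -(linear_add lC).
have l0 : l != 0 by apply: contra C10 => /eqP h; rewrite e1 fl h scale0r mul0mx.
exists ((l^-1 * l2) *: g); rewrite -scalemxAr scalemxAl -scalerA -fl2 fl scalerA.
by rewrite mulVf // scale1r.
Qed.

End RankOne.

(** * Passage to coordinates when the kernel is a line *)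

Section Induction.
Variables (K : fieldType) (k : nat).
Notation family n m := ('rV[K]_k -> 'M[K]_(n, m)).

Definition no_common_kernel n m (M : family n m) :=
  forall x : 'rV_n, (forall t, x *m M t = 0) -> x = 0.

(** [E] and [z] form a basis of the source, while [Ql] and [Qa = cokermx A] separate the target;
    [a], [b], [c] are the blocks of [M] in these coordinates. *)
Lemma one_kernel_vector r n m (M : family n m) t0 (E : 'M_(r, n)) (Ql : 'M_(m, r)) (z : 'rV_n) x :
  (2 <= r)%N -> card_gt K r -> linear M -> rank_bounded r M -> semi_prim r M ->
  n = r.+1 -> E *m M t0 *m Ql = 1%:M -> z *m M t0 = 0 -> z != 0 ->
  (2 <= \rank (ev (fun t => z *m M t *m Ql) 1%:M))%N ->
  (\rank (ev M x) <= semi_prim_bound r)%N.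
Proof.
move=> r2 cK lM rM sM nr EAQ zA z0 d2.
have cM := semi_prim_column_prop cK lM rM sM.
set A := M t0 in EAQ zA *.
have fEA : row_free (E *m A) by apply/row_freeP; exists Ql.
have rA : \rank A = r.
  apply/eqP; rewrite eqn_leq rM -{1}(eqP fEA); exact: mxrankM_maxr.
have AEA : (A <= E *m A)%MS.
  by rewrite -(geq_leqif (mxrank_leqif_sup (submxMl E A))) (eqP fEA) rA.
have backA p (y : 'M_(p, m)) : (y <= A)%MS -> y = y *m Ql *m E *m A.
  move=> /submx_trans/(_ AEA)/submxP[s ->].
  by rewrite -!mulmxA (mulmxA E A) (mulmxA _ Ql) EAQ mul1mx.
have AAA : A *m (Ql *m E) *m A = A by rewrite mulmxA -backA.
set Qa := cokermx A.
have subA p (y : 'M_(p, m)) : (y <= A)%MS = (y *m Qa == 0) by rewrite submxE.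
have rowsz q (X : 'M_(q, r)) : (\rank X + 1 <= \rank (col_mx (X *m E) z))%N.
  rewrite -[X in (_ <= X)%N](mxrank_mul_ker _ A); apply: leq_add.
    by rewrite -(mxrankMfree X fEA) mulmxA mul_col_mx -addsmxE; apply/mxrankS/addsmxSl.
  apply: leq_trans (mxrankS (_ : z <= _)%MS); first by rewrite rank_nz_row.
  by rewrite sub_capmx sub_kermx zA eqxx andbT -addsmxE addsmxSr.
pose a t := E *m M t *m Ql; pose b t := E *m M t *m Qa; pose c t := z *m M t *m Ql.
have la : linear a by apply/linear_mulr/linear_mull.
have lb : linear b by apply/linear_mulr/linear_mull.
have lc : linear c by apply/linear_mulr/linear_mull.
have iterA t j : (iter j (fun w => w *m M t *m (Ql *m E)) z *m M t <= A)%MS.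
  exact: iterated_image_sub cK rA (pencil_rank t0 lM rM t) AAA zA j.
have momE t j : moment a c t j = iter j (fun w => w *m M t *m (Ql *m E)) z *m M t *m Ql.
  elim: j => [//|j IH]; rewrite /moment !iterS -/(moment a c t j) IH /a.
  by rewrite -!mulmxA.
have mom_b t j : moment a c t j *m b t = 0.
  have := iterA t j.+1; rewrite subA momE iterS /b => /eqP h.
  by rewrite -[RHS]h -!mulmxA.
have zM t : (z *m M t <= A)%MS := iterA t 0.
have rank_mod : (\rank (ev c 1%:M) < r)%N -> forall p (Q : 'M_(m, p)),
    (forall u t, c u *m b t *m Q = 0) ->
    forall x, (\rank (ev b x *m Q) <= 'C(r - \rank (ev c 1%:M), 2))%N.
  set C := ev c 1%:M => dr p Q cbQ x1.
  have lMQ : linear (fun t => M t *m (Qa *m Q)) by apply: linear_mulr.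
  have cMQ : column_prop (fun t => M t *m (Qa *m Q)) by apply: column_prop_mulr.
  have -> : ev b x1 *m Q = ev (fun t => M t *m (Qa *m Q)) (x1 *m E).
    by apply/row_matrixP=> i; rewrite row_mul !rowK /b -!mulmxA.
  apply: leq_trans (rank_ev_total_image _ lMQ) _.
  have -> : (r - \rank C = (r - \rank C).-1.+1)%N by lia.
  apply: rank_total_image => //; first by apply: card_gtW cK; lia.
  (* [W] has rank [d + 1] in dimension [n = r + 1], so the column property leaves rank at most
     [r - d - 1]. *)
  have rW := rowsz _ C; set W := col_mx (C *m E) z in rW.
  have rW' : (\rank W <= \rank C + 1)%N.
    rewrite -addsmxE; have [le _] := mxrank_adds_leqif (C *m E) z; apply: leq_trans le _.
    by rewrite leq_add ?mxrankM_maxl // rank_nz_row.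
  have ltW : (\rank W < n)%N by lia.
  move=> t; suff : (\rank (M t *m (Qa *m Q)) + \rank W < n)%N by lia.
  apply: cM => // u; rewrite mulmxA !mul_col_mx.
  have /eqP -> : z *m M u *m Qa == 0 by rewrite -subA.
  rewrite mul0mx; suff -> : C *m E *m M u *m Qa *m Q = 0 by rewrite col_mx0.
  apply/row_matrixP=> i; rewrite row0 -!mulmxA row_mul rowK mul1mx.
  by have := cbQ (delta_mx 0 i) u; rewrite /b -!mulmxA.
(* Otherwise the hyperplane [kermx xi'] contains the Krylov space of [c t] and the kernel vector
   [z], which [M t] maps into a space with one dimension less. This loss keeps the rank on the
   hyperplane below [r]. *)
have mom_span : forall xi : 'cV_r, xi != 0 -> exists t j, moment a c t j *m xi != 0.
  move=> xi xi0; apply: NNPP => no.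
  have mxi t j : moment a c t j *m xi = 0.
    by apply/eqP/negPn/negP=> h; apply: no; exists t, j.
  set xi' := A *m Ql *m xi.
  have Exi : E *m xi' = xi by rewrite /xi' !mulmxA EAQ mul1mx.
  have rxi : \rank xi' = 1%N.
    apply/eqP; rewrite eqn_leq rank_leq_col lt0n mxrank_eq0.
    by apply: contra xi0 => /eqP h; rewrite -Exi h mulmx0.
  have [|t] := sM (kermx xi'); first by rewrite mxrank_ker rxi; lia.
  have [W [cW Wa Wmom]] := krylov (a t) (c t).
  have Wxi : W *m xi = 0 by apply: Wmom => j; apply: mxi.
  have Wb : W *m b t = 0 by apply: Wmom => j; apply: mom_b.
  have Yk : (col_mx (W *m E) z <= kermx xi')%MS.
    rewrite sub_kermx mul_col_mx -mulmxA Exi Wxi /xi' !mulmxA zA !mul0mx col_mx0 //.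
  have YM : (col_mx (W *m E) z *m M t <= W *m (E *m A))%MS.
    rewrite mul_col_mx -addsmxE addsmx_sub; apply/andP; split.
      rewrite (@backA _ (W *m E *m M t)); last by rewrite subA -!mulmxA (mulmxA E) Wb.
      rewrite -(mulmxA _ E A); apply: submxMr; rewrite -!mulmxA (mulmxA E); exact: Wa.
    by rewrite (backA _ _ (zM t)) -(mulmxA _ E A); apply: submxMr.
  have := rank_mul_sub (M t) Yk; have := mxrankS YM; rewrite (mxrankMfree W fEA).
  have := rowsz _ W; rewrite mxrank_ker rxi; lia.
have full : row_full (E + z)%MS.
  rewrite -col_leq_rank addsmxE; have := rowsz _ 1%:M; rewrite mul1mx mxrank1.
  by move=> h; apply: leq_trans h; rewrite addn1 nr.
have /sub_addsmxP[[x1 x2] /= xE] : (x <= E + z)%MS by apply: submx_full.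
have fQ : row_free (row_mx Ql Qa).
  rewrite -kermx_eq0; have := mulmx_ker (row_mx Ql Qa); rewrite mul_mx_row -row_mx0.
  case/eq_row_mx => h /eqP; rewrite -subA => /backA ->; by rewrite h !mul0mx.
rewrite -(mxrankMfree _ fQ) mul_mx_row.
have -> : ev M x *m Qa = ev b x1.
  apply/row_matrixP=> i; rewrite row_mul !rowK xE mulmxDl mulmxDl /b -!mulmxA.
  have /eqP h : z *m M (delta_mx 0 i) *m Qa == 0 by rewrite -subA.
  by rewrite -!mulmxA in h; rewrite h mulmx0 addr0.
have -> : ev M x *m Ql = ev a x1 + ev c x2.
  apply/row_matrixP=> i; rewrite row_mul linearD /= !rowK xE mulmxDl mulmxDl /a /c.
  by rewrite -!mulmxA.
apply: (@one_kernel_vector_bound _ _ _ _ a b c t0) => //.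
- by rewrite /b -mulmxA mulmx_coker mulmx0.
- by rewrite /c zA mul0mx.
Qed.

End Induction.

(** * The induction on the upper rank *)

(** The second term dominates only for [r <= 3]; the maximum lets one induction include the small
    ranks. *)
Definition column_bound r := maxn 'C(r, 2) (semi_prim_bound r).

Lemma column_boundE r : (4 <= r)%N -> column_bound r = 'C(r, 2).
Proof.
move=> r4; apply/maxn_idPl; rewrite /semi_prim_bound ifF; last by apply/negbTE; lia.
by case: r r4 => [|[|r]] // r4 /=; rewrite (binS r.+1) bin1; lia.
Qed.

Lemma column_bound_pred2 r : (2 <= r)%N -> (r + column_bound r.-2 <= semi_prim_bound r)%N.
Proof.
have [r6 _|] := leqP 6 r; last by case: r => [|[|[|[|[|[|r]]]]]].
rewrite column_boundE; last by lia.
apply: leq_trans (semi_prim_bound_pred _); lia.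
Qed.

Lemma column_bound_pred r : (2 <= r)%N -> (column_bound r.-1 + 1 <= semi_prim_bound r)%N.
Proof.
have [r5 _|] := leqP 5 r; last by case: r => [|[|[|[|[|r]]]]].
rewrite column_boundE; last by lia.
rewrite /semi_prim_bound ifF; last by apply/negbTE; lia.
lia.
Qed.

(** ['C(q + s, 2) = 'C(q, 2) + 'C(s, 2) + q s], and ['C(q.+1, 2)] exceeds ['C(q, 2)] by
    [q <= q s]. *)
Lemma bin2_superadditive q s : (0 < s)%N -> ('C(q.+1, 2) + 'C(s, 2) <= 'C(q + s, 2))%N.
Proof.
case: s => // s _; have := double_bin2 q.+1; have := double_bin2 s.+1.
have := double_bin2 (q + s.+1); rewrite addnS /=; nia.
Qed.

Section MainInduction.
Variables (K : fieldType) (k : nat).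
Notation family n m := ('rV[K]_k -> 'M[K]_(n, m)).

Definition column_bound_at r := forall n m (M : family n m), linear M -> card_gt K r ->
  rank_bounded r M -> column_prop M -> forall x, (\rank (ev M x) <= column_bound r)%N.

Lemma rank_ev_mod n m q (M : family n m) (V : 'M_(q, m)) x :
  (\rank (ev M x) <= \rank (ev (fun t => M t *m cokermx V) x) + \rank V)%N.
Proof. by rewrite ev_mulr; exact: rank_le_mul_coker. Qed.

Lemma semi_prim_rank_ev r : (2 <= r)%N -> (forall s, (s < r)%N -> column_bound_at s) ->
  forall n m (M : family n m), linear M -> card_gt K r -> rank_bounded r M ->
  semi_prim r M -> no_common_kernel M ->
  forall x, (\rank (ev M x) <= semi_prim_bound r)%N.
Proof.
move=> r2 IH n m M lM cK rM sM kM x.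
have cM := semi_prim_column_prop cK lM rM sM.
have [n0|n0] := posnP n.
  suff -> : ev M x = 0 by rewrite mxrank0.
  apply/row_matrixP=> i; rewrite rowK row0.
  suff -> : x = 0 by rewrite mul0mx.
  by apply/rowP=> j; have := ltn_ord j; rewrite {2}n0.
have [t0 rA] : exists t0, \rank (M t0) = r.
  have [|H _ rH] := @exists_hyperplane_above K 1 n 0; first by rewrite mxrank0.
  have [t ht] := sM H rH; exists t; apply/eqP; rewrite eqn_leq rM.
  exact: leq_trans ht (mxrankM_maxr _ _).
set A := M t0 in rA *; set Q := cokermx A.
have rk : \rank (kermx A) = (n - r)%N by rewrite mxrank_ker rA.
have rn : (r < n)%N.
  have := cM _ 1 1%:M 0 _ _ t0; rewrite mulmx1 mxrank0 addn0 -/A rA; apply=> // t.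
  by rewrite !mul0mx.
have AAA : A *m pinvmx A *m A = A by rewrite mulmxKpV.
have iterA t (z : 'rV_n) j : z *m A = 0 ->
    (iter j (fun w => w *m M t *m pinvmx A) z *m M t <= A)%MS.
  by move=> zA; exact: iterated_image_sub cK rA (pencil_rank t0 lM rM t) AAA zA j.
have kA i : row i (kermx A) *m A = 0 by rewrite -row_mul mulmx_ker row0.
have kMA t : (kermx A *m M t <= A)%MS.
  by apply/row_subP=> i; rewrite row_mul; exact: (iterA t _ 0 (kA i)).
(* Modulo such an [L], all members kill [Ker A], and the column property lowers the rank to
   [r - 1]. *)
have rank_line p (L : 'M_(p, m)) : (\rank L <= 1)%N -> (forall t, (kermx A *m M t <= L)%MS) ->
    (\rank (ev M x) <= semi_prim_bound r)%N.
  move=> L1 kL; apply: leq_trans (column_bound_pred r2).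
  apply: leq_trans (rank_ev_mod _ L _) _; apply: leq_add L1.
  apply: IH; [lia|exact: linear_mulr|by apply: card_gtW cK; lia| |exact: column_prop_mulr].
  move=> t; suff : (\rank (M t *m cokermx L) + \rank (kermx A) < n)%N by rewrite rk; lia.
  by apply: cM => [|u]; [rewrite rk; lia|apply/eqP; rewrite -submxE].
have [small|/not_all_ex_not[t1 big]] := classic (forall t, (\rank (M t *m Q) <= r.-2)%N).
  apply: leq_trans (column_bound_pred2 r2).
  apply: leq_trans (rank_ev_mod _ A _) _; rewrite rA addnC leq_add2l.
  apply: IH; [lia|exact: linear_mulr|by apply: card_gtW cK; lia|exact: small|].
  exact: column_prop_mulr.
(* [Z] lifts [kermx A *m M t] through [A]. The identities with [j = 0] and [j = 1] show that
   [M t *m Q] kills both [Ker A] and [Z], a space of dimension at least [n - r] plus the rank of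
   [kermx A *m M t]. *)
have sum_le t : (\rank (M t *m Q) + \rank (kermx A *m M t) <= r)%N.
  set X := M t; set Z := kermx A *m X *m pinvmx A.
  have ZA : Z *m A = kermx A *m X by apply: mulmxKpV; exact: kMA.
  have : (kermx A + Z <= kermx (X *m Q))%MS.
    rewrite addsmx_sub !sub_kermx (mulmxA (kermx A)) (mulmxA Z) -!submxE kMA; apply/row_subP=> i.
    rewrite (row_mul i Z X) (row_mul i (kermx A *m X)) (row_mul i (kermx A)); exact: (iterA t _ 1 (kA i)).
  move/mxrankS; rewrite mxrank_ker; have := rank_leq_row (X *m Q).
  have := mxrank_mul_ker (kermx A + Z)%MS A.
  have : (\rank (kermx A *m X) <= \rank ((kermx A + Z)%MS *m A))%N.
    by rewrite -ZA; apply/mxrankS/submxMr/addsmxSr.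
  have : (\rank (kermx A) <= \rank ((kermx A + Z) :&: kermx A))%N.
    by apply: mxrankS; rewrite sub_capmx addsmxSl submx_refl.
  rewrite rk; lia.
(* Rank [r - 1] for [M t *m Q] and rank 2 on [Ker A] could be reached by one member, against
   [sum_le]. *)
have rank1 t : (\rank (kermx A *m M t) <= 1)%N.
  rewrite leqNgt; apply/negP=> gt1.
  have lQ : linear (fun t => M t *m Q) by apply: linear_mulr.
  have lk : linear (fun t => kermx A *m M t) by apply: linear_mull.
  have [|||t' [h1 h2]] := @pencil_good_ranks K k r _ _ _ _ _ _ r.-1 2 t1 t cK lQ lk.
  - by rewrite /=; lia.
  - by [].
  - by lia.
  have := sum_le t'; lia.
have [[g kg]|[f kf]] := rank_one_family (linear_mull (kermx A) lM) rank1.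
  by apply: rank_line kg; exact: rank_leq_row.
(* With a common column factor [f], the vectors of [Ker A] whose coordinates are killed by [f] are
   killed by every member, hence are zero. *)
have rk1 : (\rank (kermx A) <= 1)%N.
  have : kermx f *m kermx A = 0.
    apply/row_matrixP=> i; rewrite row0; apply: kM => t.
    by have [g eg] := kf t; rewrite row_mul -mulmxA eg mulmxA -row_mul mulmx_ker row0 mul0mx.
  move/eqP; rewrite -sub_kermx => /mxrankS; rewrite !mxrank_ker.
  have := rank_leq_col f; have := rank_leq_col A; lia.
have nr : n = r.+1 by move: rk1; rewrite rk; lia.
have k0 : kermx A != 0 by rewrite -mxrank_eq0 rk; lia.
have [z zk z0] := rowV0Pn k0.
have zA : z *m A = 0 by apply/eqP; rewrite -sub_kermx.
have kz : (kermx A <= z)%MS.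
  by rewrite -(geq_leqif (mxrank_leqif_sup zk)) rank_nz_row.
have [E [Ql EAQ]] := rank_ge_section (eq_leq (esym rA)).
set C := ev (fun t => z *m M t *m Ql) 1%:M.
have [d1|d2] := leqP (\rank C) 1; last first.
  exact: one_kernel_vector r2 cK lM rM sM nr EAQ zA z0 d2.
have AEA : (A <= E *m A)%MS.
  rewrite -(geq_leqif (mxrank_leqif_sup (submxMl E A))) rA.
  by apply: (@rank_section_le _ _ _ _ 1%:M _ Ql); rewrite mul1mx EAQ unitmx1.
apply: (rank_line _ (C *m (E *m A))); first by apply: leq_trans (mxrankM_maxl _ _) d1.
move=> t; apply: submx_trans (submxMr _ kz) _.
have /submx_trans/(_ AEA)/submxP[s es] : (z *m M t <= A)%MS := iterA t z 0 zA.
have -> : z *m M t = t *m C *m (E *m A).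
  have lc : linear (fun t => z *m M t *m Ql) by apply/linear_mulr/linear_mull.
  by rewrite (mul_ev lc) mul1mx es -(mulmxA s) EAQ mulmx1.
by rewrite -mulmxA submxMl.
Qed.

Lemma exists_minimal_rank n (P : 'M[K]_n -> Prop) U : P U ->
  exists2 U, P U & forall V, P V -> (\rank U <= \rank V)%N.
Proof.
move: {2}(\rank U) (leqnn (\rank U)) => d; elim: d U => [|d IH] U leU PU.
  by exists U => // V _; rewrite (leq_trans leU).
have [[V [PV lt]]|no] := classic (exists V, P V /\ (\rank V < \rank U)%N).
  by apply: (IH V) => //; rewrite -ltnS (leq_trans lt).
exists U => // V PV; rewrite leqNgt; apply/negP=> lt; apply: no; by exists V.
Qed.

(** [U] is chosen minimal among the subspaces where the rank plus the codimension stays at most [r];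
    the whole space is one of them. Minimality makes the restriction to [U] semi-primitive. *)
Lemma semi_prim_or_decomposed r : (forall s, (s < r)%N -> column_bound_at s) ->
  forall n m (M : family n m), linear M -> card_gt K r -> rank_bounded r M ->
  column_prop M -> no_common_kernel M ->
  forall x, (\rank (ev M x) <= column_bound r)%N.
Proof.
move=> IH n m M lM cK rM cM kM x.
have [r1|r2] := leqP r 1.
  apply: leq_trans (rank_ev_total_image _ lM) _.
  apply: leq_trans (rank_total_image cK lM rM cM) _.
  by rewrite leq_max; case: r r1 {IH cK rM} => [|[|r]] // _; rewrite orbC.
have [U Ur Umin] : exists2 U : 'M_n, forall t, (\rank (U *m M t) + (n - \rank U) <= r)%N &
    forall V : 'M_n, (forall t, (\rank (V *m M t) + (n - \rank V) <= r)%N) -> (\rank U <= \rank V)%N.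
  apply: (exists_minimal_rank (U := 1%:M)) => t.
  by rewrite mul1mx mxrank1 subnn addn0.
have Usmall (V : 'M_n) : (\rank V < \rank U)%N -> exists t, (r < \rank (V *m M t) + (n - \rank V))%N.
  move=> lt; apply: NNPP => no; move: lt; apply/negP; rewrite -leqNgt; apply: Umin => t.
  rewrite leqNgt; apply/negP=> h; apply: no; by exists t.
have leU := rank_leq_row U.
have [Un|Un] := eqVneq (\rank U) n.
  rewrite leq_max (semi_prim_rank_ev r2 IH) ?orbT // => H rH.
  have [|t ht] := Usmall H; first by rewrite Un; lia.
  exists t; lia.
have ltU : (\rank U < n)%N by rewrite ltn_neqAle Un.
set q := (r - (n - \rank U))%N.
have qr : (q + (n - \rank U) = r)%N by have := Ur 0; rewrite /q; lia.
have lN : linear (fun t => row_base U *m M t) by apply: linear_mull.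
have rN : rank_bounded q (fun t => row_base U *m M t).
  by move=> t; rewrite (eqmxMr _ (eq_row_base U)); have := Ur t; lia.
have cKq : card_gt K q by apply: card_gtW cK; lia.
have cN : column_prop (fun t => row_base U *m M t).
  apply: (semi_prim_column_prop cKq lN rN) => H rH.
  have rHU : \rank (H *m row_base U) = \rank H by rewrite mxrankMfree ?row_base_free.
  have [|t ht] := Usmall <<H *m row_base U>>%MS; first by rewrite mxrank_gen rHU; lia.
  exists t; move: ht; rewrite mxrank_gen rHU (eqmxMr _ (genmxE _)) -mulmxA; lia.
set V := total_image (fun t => row_base U *m M t).
have rV : (\rank V <= 'C(q.+1, 2))%N by apply: rank_total_image.
rewrite leq_max; apply/orP; left.
apply: leq_trans (rank_ev_mod _ V _) _; rewrite addnC.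
have s0 : (0 < n - \rank U)%N by rewrite subn_gt0.
(* The image of [U] spans at most ['C(q.+1, 2)] dimensions. Modulo it [U] is killed, so the column
   property leaves rank below [n - \rank U]. *)
have := bin2_superadditive q s0; rewrite qr; apply: leq_trans; apply: leq_add => //.
have lQ : linear (fun t => M t *m cokermx V) by apply: linear_mulr.
apply: leq_trans (rank_ev_total_image _ lQ) _.
have -> : (n - \rank U = (n - \rank U).-1.+1)%N by lia.
apply: rank_total_image => //; first by apply: card_gtW cK; lia.
  move=> t; suff : (\rank (M t *m cokermx V) + \rank (row_base U) < n)%N.
    by rewrite eq_row_base; lia.
  apply: cM => [|u]; first by rewrite eq_row_base.
  by apply/eqP; rewrite -submxE; exact: (sub_total_image lN).
exact: column_prop_mulr.
Qed.

Lemma exists_common_kernel n m (M : family n m) : linear M ->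
  exists Z : 'M_n, forall p (v : 'M_(p, n)), (v <= Z)%MS <-> forall t, v *m M t = 0.
Proof.
move=> lM; exists (\bigcap_(i < k) kermx (M (delta_mx 0 i)))%MS => p v; split.
  move=> vZ t; rewrite (row_sum_ev lM) mulmx_sumr big1 // => i _.
  have : (v <= kermx (M (delta_mx 0 i)))%MS.
    by apply: submx_trans vZ _; apply: (bigcapmx_inf i).
  by rewrite sub_kermx -scalemxAr => /eqP->; rewrite scaler0.
by move=> vM; apply/sub_bigcapmxP=> i _; rewrite sub_kermx vM.
Qed.

(** The common kernel [Z] is split off by restricting to a complement; the column property survives
    because [Z] can be added to any [W]. *)
Theorem column_bound_holds r : column_bound_at r.
Proof.
elim/ltn_ind: r => r IH n m M lM cK rM cM x.
have [Z hZ] := exists_common_kernel lM.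
set E := row_base Z^C%MS.
have ZM t : Z *m M t = 0 by move: t; apply/hZ.
have lN : linear (fun t => E *m M t) by apply: linear_mull.
have capZ p (v : 'M_(p, n)) : (v <= Z)%MS -> (v <= Z^C)%MS -> v = 0.
  move=> vZ vC; apply/eqP; rewrite -submx0 -(capmx_compl Z).
  by rewrite sub_capmx vZ.
have [[u v] /= xE] : exists u, x = u.1 *m Z + u.2 *m E.
  apply/sub_addsmxP; apply: submx_trans (submx1 _) _; rewrite sub1mx.
  rewrite /row_full (adds_eqmx (eqmx_refl Z) (eq_row_base _)).
  exact: addsmx_compl_full.
have -> : ev M x = ev (fun t => E *m M t) v.
  by apply/row_matrixP=> i; rewrite !rowK xE mulmxDl -mulmxA ZM mulmx0 add0r mulmxA.
have subE p (w : 'M_(p, _)) : (w *m E <= Z^C)%MS.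
  by apply: submx_trans (submxMl _ _) _; rewrite eq_row_base.
apply: (semi_prim_or_decomposed IH) => //.
- by move=> t; apply: leq_trans (mxrankM_maxr _ _) (rM t).
- move=> p w Q W ltW WNQ t.
  have rWZ : \rank (Z + W *m E)%MS = (\rank Z + \rank W)%N.
    rewrite mxrank_disjoint_sum ?mxrankMfree ?row_base_free //.
    by apply: capZ; [exact: capmxSl|exact: submx_trans (capmxSr _ _) (subE _ _)].
  have rC := mxrank_compl Z; have leZ := rank_leq_row Z.
  have : (\rank (M t *m Q) + \rank (Z + W *m E)%MS < n)%N.
    apply: cM => [|u']; first by rewrite rWZ; lia.
    apply/eqP; rewrite -mulmxA -sub_kermx addsmx_sub !sub_kermx (mulmxA Z) ZM mul0mx eqxx.
    by rewrite (mulmxA (W *m E)) -(mulmxA W E (M u')) WNQ eqxx.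
  rewrite rWZ; have : (\rank (E *m M t *m Q) <= \rank (M t *m Q))%N.
    by rewrite -mulmxA mxrankM_maxr.
  lia.
move=> y yN; have : y *m E = 0.
  apply: capZ => //; apply/hZ => t; rewrite -mulmxA; exact: yN.
by rewrite -(mul0mx _ E) => /(row_free_inj (row_base_free _)).
Qed.

End MainInduction.

(** * Families of matrices and subspaces *)

Section Subspaces.
Variable K : fieldType.

Lemma row_free_of_free n k (X : 'I_k -> 'cV[K]_n) : free [seq X i | i <- enum 'I_k] ->
  row_free (\matrix_i (X i)^T).
Proof.
move=> fX.
have sX : size [seq X i | i <- enum 'I_k] = k by rewrite size_map size_enum_ord.
have nthX (i : 'I_k) : [seq X i | i <- enum 'I_k]`_i = X i.
  by rewrite (nth_map i) ?size_enum_ord // nth_ord_enum.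
rewrite -kermx_eq0; apply/rowV0P=> v /sub_kermxP; rewrite mulmx_sum_row => v0.
have fT : free (in_tuple [seq X i | i <- enum 'I_k]) by [].
have h : \sum_(i < k) v 0 i *: X i = 0.
  apply: trmx_inj; rewrite trmx0 -[RHS]v0 raddf_sum; apply: eq_bigr => i _.
  by rewrite /= linearZ rowK.
apply/rowP=> i; rewrite [RHS]mxE.
move/freeP: fT; rewrite /= => /(_ (fun j => v 0 (cast_ord sX j))).
move=> /(_ _ (cast_ord (esym sX) i)); rewrite cast_ordKV; apply.
rewrite -[RHS]h (reindex (cast_ord (esym sX))) /=; last first.
  by exists (cast_ord sX) => j _; rewrite ?cast_ordK ?cast_ordKV.
by apply: eq_bigr => j _; rewrite cast_ordKV nthX.
Qed.

Definition rows_of n (U : {vspace 'cV[K]_n}) : 'M[K]_(\dim U, n) :=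
  \matrix_i ((vbasis U)`_i)^T.

Lemma rows_of_free n (U : {vspace 'cV[K]_n}) : row_free (rows_of U).
Proof.
apply: row_free_of_free.
suff -> : [seq (vbasis U)`_i | i : 'I_(\dim U) <- enum 'I_(\dim U)] = vbasis U by apply: basis_free (vbasisP U).
apply: (@eq_from_nth _ 0) => [|i]; rewrite size_map size_enum_ord ?size_tuple // => lt.
by rewrite (nth_map (Ordinal lt)) ?size_enum_ord // nth_enum_ord.
Qed.

Lemma mem_rows_of n (U : {vspace 'cV[K]_n}) x : (x \in U) = (x^T <= rows_of U)%MS.
Proof.
apply/idP/idP.
  move=> xU; rewrite (coord_vbasis xU) raddf_sum; apply: summx_sub => i _.
  rewrite /= linearZ scalemx_sub //.
  by have := row_sub i (rows_of U); rewrite rowK.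
case/submxP=> v xv; rewrite -[x]trmxK xv mulmx_sum_row raddf_sum.
apply: rpred_sum => i _; rewrite /= linearZ rowK /= trmxK rpredZ //.
by apply: vbasis_mem; apply: mem_nth; rewrite size_tuple.
Qed.

Lemma dim_of_mem n w (U : {vspace 'cV[K]_n}) (X : 'M_(w, n)) :
  (forall x : 'cV_n, (x \in U) = (x^T <= X)%MS) -> \dim U = \rank X.
Proof.
move=> UX; rewrite -(eqP (rows_of_free U)); apply/eqmx_rank/eqmxP/eqmxP/andP; split.
  apply/row_subP=> i; rewrite rowK -UX; apply: vbasis_mem; apply: mem_nth.
  by rewrite size_tuple.
by apply/row_subP=> i; rewrite -[row i X]trmxK -mem_rows_of UX trmxK row_sub.
Qed.

Lemma mem_ker_mulmx n p (Y : 'M[K]_(p, n)) (x : 'cV_n) :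
  (x \in lker (linfun (fun x : 'cV_n => Y *m x))) = (x^T <= kermx Y^T)%MS.
Proof.
rewrite memv_ker (lfunE (mulmx Y)) sub_kermx -trmx_mul.
by apply/eqP/eqP=> [->|/(congr1 trmx)]; rewrite ?trmxK trmx0.
Qed.

End Subspaces.

(** * From matrix spaces to linear families *)

Section Interface.
Variables (K : fieldType) (m n : nat) (S : {vspace 'M[K]_(m, n)}).

Definition transposed_family (t : 'rV[K]_(\dim S)) : 'M[K]_(n, m) :=
  \sum_i t 0 i *: ((vbasis S)`_i)^T.
Let M := transposed_family.

Lemma transposed_family_linear : linear M.
Proof.
move=> l u v; rewrite /M /transposed_family scaler_sumr -big_split /=.
by apply: eq_bigr => i _; rewrite !mxE scalerDl scalerA.
Qed.
Let lM := transposed_family_linear.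

Lemma mem_transposed_family t : (M t)^T \in S.
Proof.
rewrite raddf_sum rpred_sum // => i _; rewrite /= linearZ /= trmxK rpredZ //.
by apply: vbasis_mem; apply: mem_nth; rewrite size_tuple.
Qed.

Lemma transposed_family_onto X : X \in S -> exists t, X = (M t)^T.
Proof.
move=> XS; exists (\row_i coord (vbasis S) i X).
rewrite {1}(coord_vbasis XS) raddf_sum; apply: eq_bigr => i _.
by rewrite /= linearZ /= trmxK mxE.
Qed.

Lemma dim_img_at x : (\dim (img_at S x) <= \rank (ev M x^T))%N.
Proof.
rewrite -(eqP (rows_of_free (img_at S x))); apply: mxrankS; apply/row_subP=> i.
rewrite rowK.
have : (vbasis (img_at S x))`_i \in img_at S x.
  by apply: vbasis_mem; apply: mem_nth; rewrite size_tuple.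
case/memv_imgP=> X /transposed_family_onto[t ->] ->.
rewrite (lfunE (mulmxr x)) /= trmx_mul trmxK; exact: sub_ev.
Qed.

Lemma urk_rank_bounded r : is_urk S r -> rank_bounded r M.
Proof. by case=> _ h t; rewrite -mxrank_tr h // mem_transposed_family. Qed.

Lemma reduced_no_common_kernel : reduced S -> no_common_kernel M.
Proof.
case=> h _ x xM; apply: trmx_inj; rewrite trmx0; apply: h => X.
by case/transposed_family_onto=> t ->; rewrite -trmx_mul xM trmx0.
Qed.

(** If the rank on a hyperplane stayed at most [r - 1], the kernels would meet it in dimension at
    least [(n - 1) - (r - 1)], the defectiveness index. *)
Lemma semi_primitive_semi_prim r : is_urk S r -> semi_primitive S -> semi_prim r M.
Proof.
move=> urk [_ sp] H rH; apply: NNPP => no.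
have [[X0 X0S rX0] Xr] := urk.
have dim_ker (X : 'M[K]_(m, n)) : \dim (kerM X) = (n - \rank X)%N.
  by rewrite (dim_of_mem (mem_ker_mulmx X)) mxrank_ker mxrank_tr.
have rn : (r <= n)%N by rewrite -rX0 rank_leq_col.
have idx : is_defect_index S (n - r).
  split=> [X XS|c' c'S]; first by rewrite dim_ker leq_sub2l // Xr.
  by have := c'S _ X0S; rewrite dim_ker rX0.
apply: (sp _ idx); set U := lker (linfun (fun x : 'cV_n => (cokermx H)^T *m x)).
have UH x : (x \in U) = (x^T <= H)%MS.
  by rewrite mem_ker_mulmx trmxK sub_kermx -submxE.
exists U; split; first by rewrite (dim_of_mem UH).
move=> X XS; have [t Xt] := transposed_family_onto XS.
have memI x : (x \in (kerM X :&: U)%VS) = (x^T <= H :&: kermx (M t))%MS.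
  by rewrite memv_cap UH sub_capmx andbC mem_ker_mulmx Xt trmxK.
rewrite (dim_of_mem memI).
have := mxrank_mul_ker H (M t).
have : (\rank (H *m M t) < r)%N.
  by rewrite ltnNge; apply/negP=> h; apply: no; exists t.
lia.
Qed.

(** [row_ebase X] starts with a basis of the row space of [X]; the order is reversed because
    decomposed spaces have their zero block at the end. *)
Lemma unit_last_rows p q (X : 'M[K]_(q, p)) : exists2 L : 'M_p, L \in unitmx &
  (forall i : 'I_p, (p - \rank X <= i)%N -> (row i L <= X)%MS) /\
  (forall r, r = (p - \rank X)%N ->
     (X <= \matrix_(i < p - r) row (Ordinal (low_row_proof i)) L)%MS).
Proof.
set L := row_perm (perm rev_ord_inj) (row_ebase X).
have rowL i : row i L = row (rev_ord i) (row_ebase X) by apply/rowP=> j; rewrite !mxE permE.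
have row_eb (j : 'I_p) (h : 'I_(\rank X)) : h = j :> nat ->
    row j (row_ebase X) = row h (row_base X).
  move=> hj; rewrite /row_base (row_mul h) [LHS]rowE; congr (_ *m _); apply/rowP=> l.
  by rewrite !mxE eqxx /= ltn_ord andbT -val_eqE /= -hj eq_sym.
have leX := rank_leq_col X.
exists L; first by rewrite /L row_permE unitmx_mul unitmx_perm row_ebase_unit.
split=> [i hi|r er].
  have lt : (rev_ord i < \rank X)%N by rewrite /=; have := ltn_ord i; lia.
  by rewrite rowL (@row_eb _ (Ordinal lt)) // (submx_trans (row_sub _ _)) // eq_row_base.
apply: (@submx_trans _ _ _ _ _ _ (row_base X)); first by rewrite eq_row_base.
apply/row_subP=> h.
have lt : (\rank X - h.+1 < p - r)%N by have := ltn_ord h; lia.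
have <- : row (Ordinal lt) (\matrix_(i < p - r) row (Ordinal (low_row_proof i)) L) = row h (row_base X).
  by rewrite rowK rowL; apply: row_eb; rewrite /=; have := ltn_ord h; lia.
exact: row_sub.
Qed.

(** Base changes adapted to [Q] and [W] put the space in decomposed form with [r = m - \rank Q] and
    [s = n - \rank W]. A member violating the conclusion would give a lower block of rank [s]. *)
Lemma column_property_column_prop : column_property S -> column_prop M.
Proof.
move=> cp p w Q W ltW WMQ t; rewrite ltnNge; apply/negP=> big.
have [L uL [Llow Lspan]] := unit_last_rows Q^T.
have [R uR [Rlow Rspan]] := unit_last_rows W.
set r := (m - \rank Q)%N; set s := (n - \rank W)%N.
have hr : (r <= m)%N by apply: leq_subr.
have hs : (s <= n)%N by apply: leq_subr.
have hs1 : (1 <= s)%N by rewrite subn_gt0.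
pose f (X : 'M[K]_(m, n)) := L *m X *m R^T.
have lf : linear f.
  by move=> l X Y; rewrite /f mulmxDr mulmxDl -scalemxAr -scalemxAl.
pose F : {linear 'M[K]_(m, n) -> 'M[K]_(m, n)} := mulmxr R^T \o mulmx L.
set S' := (linfun F @: S)%VS.
have memS' Y : reflect (exists2 X, X \in S & Y = f X) (Y \in S').
  apply: (iffP memv_imgP) => -[X XS ->]; exists X => //; by rewrite lfunE.
have dec : decomposed r s S'.
  move=> _ /memS'[X /transposed_family_onto[u ->] ->] i j ri sj.
  have /submxP[a ai] : (row i L <= Q^T)%MS by apply: Llow; rewrite mxrank_tr.
  have /submxP[b bj] : (row j R <= W)%MS by apply: Rlow.
  have -> : f (M u)^T i j = (row i L *m (M u)^T *m (row j R)^T) 0 0.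
    by rewrite /f -row_mul mxE [RHS]mxE; apply: eq_bigr => h _; rewrite !mxE.
  rewrite ai bj trmx_mul !mulmxA -(mulmxA a) -trmx_mul -(mulmxA a) -trmx_mul mulmxA WMQ.
  by rewrite trmx0 mulmx0 mul0mx mxE.
have eq : mxspace_equiv S S'.
  exists (invmx L), (invmx R^T); rewrite !unitmx_inv uL unitmx_tr uR; do 2!split=> //.
  move=> X; split.
    move=> XS; exists (f X); first by apply/memS'; exists X.
    by rewrite /f -mulmxA mulmxK ?unitmx_tr // mulKmx.
  by case=> _ /memS'[Y YS ->] ->; rewrite /f -mulmxA mulmxK ?unitmx_tr // mulKmx.
have XS' : f (M t)^T \in S' by apply/memS'; exists (M t)^T => //; apply: mem_transposed_family.
have := cp r s hr hs1 hs S' dec eq _ XS'; apply/negP; rewrite negbK.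
rewrite eqn_leq rank_leq_col /=.
set B := lower_block _ _ _.
pose J : 'M[K]_(s, n) := pid_mx s.
(* [J] pads the lower block with zero columns, which is what decomposedness puts there; the last
   rows of [L] span the rows of [Q^T], so the rank of [M t *m Q] is at most that of [B]. *)
have BJ : (\matrix_(i < m - r) row (Ordinal (low_row_proof i)) L) *m (M t)^T *m R^T = B *m J.
  apply/matrixP=> i j; set i' := Ordinal (low_row_proof i).
  transitivity (f (M t)^T i' j).
    rewrite /f -!mulmxA mxE [RHS]mxE; apply: eq_bigr => h _; by rewrite !mxE.
  have [js|sj] := ltnP j s; last first.
    rewrite (dec _ XS') // ?leq_addr // mxE big1 // => h _; rewrite !mxE.
    by rewrite ltn_eqF ?(leq_trans (ltn_ord h)) // mulr0.
  rewrite [RHS]mxE (bigD1 (Ordinal js)) //= big1 => [|h hj].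
    have -> : J (Ordinal js) j = 1 by rewrite mxE /= eqxx js.
    by rewrite addr0 mulr1 [RHS]mxE; congr (f _ _ _); exact: val_inj.
  by rewrite !mxE; case: eqP => [e|]; rewrite ?mulr0 //; case/eqP: hj; apply: val_inj.
have rQ : r = (m - \rank Q^T)%N by rewrite mxrank_tr.
have /submxP[D eD] := Lspan r rQ.
apply: leq_trans (mxrankM_maxl B J); rewrite -BJ.
apply: leq_trans (mxrankM_maxr D _); rewrite !mulmxA -eD.
rewrite mxrankMfree ?row_free_unit ?unitmx_tr //.
rewrite -trmx_mul mxrank_tr leq_subLR addnC; exact: big.
Qed.

End Interface.

Theorem mainTheorem6 (K : fieldType) (m n : nat) (S : {vspace 'M[K]_(m, n)}) (r : nat) :
  reduced S -> is_urk S r -> card_gt K r -> (2 <= r)%N ->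
  (column_property S -> (4 <= r)%N -> forall t, is_trk S t -> (t <= 'C(r, 2))%N) /\
  (semi_primitive S -> forall t, is_trk S t -> (t <= 3 + 'C(r.-1, 2))%N).
Proof.
move=> redS urk cK r2; have lM := @transposed_family_linear K m n S.
have rM := urk_rank_bounded urk; split=> [cp r4|sp] t [[x <-] _].
  rewrite -column_boundE //; apply: leq_trans (dim_img_at S x) _.
  exact/column_bound_holds/column_property_column_prop.
apply: leq_trans (dim_img_at S x) _.
apply: leq_trans (semi_prim_rank_ev r2 _ lM cK rM _ _ _) _.
- by move=> s _; exact: column_bound_holds.
- exact: semi_primitive_semi_prim.
- exact: reduced_no_common_kernel.
by rewrite /semi_prim_bound; case: ifP => // r2'; rewrite (leq_trans r2').
Qed.
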